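(* Let $r\ge 1$ be an integer and let $\omega$ be an alternating $r$-linear form on the complex vector space $M_{r+1}(\mathbb C)$ such that $\omega$ vanishes whenever one of its arguments is the identity matrix $\mathbf 1$. Then, for $\lambda=(\lambda_0\ge\dots\ge\lambda_r)\in\mathbb Z^{r+1}$ with $\lambda_r=0$ and for every $g\in M_{r+1}(\mathbb C)$, $$\omega\left(g^{\lambda_0+r},g^{\lambda_1+r-1},\dots,g^{\lambda_{r-1}+1}\right)=\chi_\lambda(g)\cdot\omega\left(g^r,g^{r-1},\dots,g\right).$$
   Context: $M_{r+1}(\mathbb C)$ is the space of complex $(r+1)\times(r+1)$ matrices. For $\lambda=(\lambda_0\ge\dots\ge\lambda_r)\in\mathbb Z^{r+1}$, $\chi_\lambda:GL_{r+1}(\mathbb C)\to\mathbb C$ is the character of the irreducible rational representation of $GL_{r+1}(\mathbb C)$ with highest weight $\lambda$, where $\lambda$ corresponds to the character $\mathrm{diag}(z_0,\dots,z_r)\mapsto\prod_i z_i^{\lambda_i}$ of the diagonal torus. When $\lambda\in\mathbb Z_{\ge0}^{r+1}$ (as is the case here), $\chi_\lambda$ is the restriction of a unique polynomial function on $M_{r+1}(\mathbb C)$, also denoted $\chi_\lambda$. On the left-hand side, the $i$-th argument ($i=0,\dots,r-1$) is $g^{\lambda_i+r-i}$; on the right-hand side it is $g^{r-i}$. *)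

(* Defs.v *)
From mathcomp Require Import all_boot all_order all_algebra.
From mathcomp Require Import reals complex mpoly.

Set Implicit Arguments.
Unset Strict Implicit.
Unset Printing Implicit Defensive.

Import GRing.Theory.
Local Open Scope ring_scope.

Section Multilinear.
Variables (K : fieldType) (V : lmodType K) (r : nat).

Definition ffun_upd (m : {ffun 'I_r -> V}) (i : 'I_r) (x : V) :
  {ffun 'I_r -> V} := [ffun j => if j == i then x else m j].

Definition multilinear (w : {ffun 'I_r -> V} -> K) : Prop :=
  forall (m : {ffun 'I_r -> V}) (i : 'I_r) (a : K) (x y : V),
    w (ffun_upd m i (a *: x + y))
    = a * w (ffun_upd m i x) + w (ffun_upd m i y).

Definition alternating (w : {ffun 'I_r -> V} -> K) : Prop :=
  forall (m : {ffun 'I_r -> V}) (i j : 'I_r), i != j -> m i = m j -> w m = 0.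

End Multilinear.

Section Representations.
Variables (K : fieldType) (n : nat).

(* A polynomial in the n ^ 2 entries of a matrix, evaluated at [g]. *)
Definition mx_eval (p : {mpoly K[n * n]}) (g : 'M[K]_n) : K :=
  p.@[fun k => mxvec g 0 k].

Definition polynomial_function (f : 'M[K]_n -> K) : Prop :=
  exists p : {mpoly K[n * n]}, forall g, f g = mx_eval p g.

(* The regular functions on GL_n: the coordinate ring is K[x_ij][1 / det].
   Values at singular matrices are irrelevant. *)
Definition regular_on_GL (f : 'M[K]_n -> K) : Prop :=
  exists (p : {mpoly K[n * n]}) (k : nat),
    forall g, g \in unitmx -> f g = mx_eval p g / \det g ^+ k.

(* A representation of GL_n on the space of column vectors of size [d] is
   encoded by a function on all matrices, of which only the values on
   invertible matrices matter. *)
Variables (d : nat) (rho : 'M[K]_n -> 'M[K]_d).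

Definition GL_representation : Prop :=
  rho 1%:M = 1%:M /\
  {in unitmx &, forall g h, rho (g *m h) = rho g *m rho h}.

Definition rational_representation : Prop :=
  GL_representation /\ forall i j, regular_on_GL (fun g => rho g i j).

Definition invariant_subspace (U : {vspace 'cV[K]_d}) : Prop :=
  forall g v, g \in unitmx -> v \in U -> rho g *m v \in U.

Definition irreducible_representation : Prop :=
  (0 < d)%N /\
  forall U : {vspace 'cV[K]_d}, invariant_subspace U -> U = 0%VS \/ U = fullv.

Definition upper_unitriangular (u : 'M[K]_n) : Prop :=
  (forall i j : 'I_n, (j < i)%N -> u i j = 0) /\ (forall i, u i i = 1).

Definition torus_character (lam : 'I_n -> int) (z : 'rV[K]_n) : K :=
  \prod_i z 0 i ^ lam i.

(* [v] has weight [lam] for the diagonal torus and is fixed by the unipotent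
   radical of the Borel subgroup of upper triangular matrices. *)
Definition highest_weight_vector (lam : 'I_n -> int) (v : 'cV[K]_d) : Prop :=
  [/\ v != 0,
      forall z : 'rV[K]_n, (forall i, z 0 i != 0) ->
        rho (diag_mx z) *m v = torus_character lam z *: v
    & forall u, upper_unitriangular u -> rho u *m v = v].

Definition has_highest_weight (lam : 'I_n -> int) : Prop :=
  exists v, highest_weight_vector lam v.

End Representations.

(* [chi] is the polynomial function on M_n whose restriction to GL_n is the
   character of the irreducible rational representation of highest weight
   [lam]; these conditions determine [chi], since that representation is unique
   up to isomorphism and GL_n is Zariski dense in M_n. *)
Definition is_irreducible_character (K : fieldType) (n : nat)
    (lam : 'I_n -> int) (chi : 'M[K]_n -> K) : Prop :=
  polynomial_function chi /\
  exists (d : nat) (rho : 'M[K]_n -> 'M[K]_d),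
    [/\ rational_representation rho,
        irreducible_representation rho,
        has_highest_weight rho lam
      & forall g, g \in unitmx -> chi g = \tr (rho g)].

(* Main.v *)
Require Import Defs.
From HB Require Import structures.
From mathcomp Require Import all_boot all_order all_algebra all_fingroup.
From mathcomp Require Import reals complex mpoly.
From mathcomp Require Import zify ring.
From mathcomp Require boolp.

Set Implicit Arguments.
Unset Strict Implicit.
Unset Printing Implicit Defensive.

Import GRing.Theory.
Local Open Scope ring_scope.

(* Multiplying the representation by a power of the determinant makes it a
   polynomial representation [P] of the monoid of all matrices.  Let [lie] be
   its differential and let [f] be the trace of [P] on the diagonal torus.  The
   Casimir operator commutes with [P], hence is a scalar, read off the highest
   weight vector.  Computing its trace against a torus element, by moving each
   root vector around the trace, turns this into a differential equation for
   [f]; multiplied by the Vandermonde determinant [V], it says that [f * V] is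
   an eigenvector of the Laplacian, so all its exponents have the same norm as
   [l + rho].  Together with the antisymmetry of [f * V] and the bound on the
   weights of [P], this forces [f * V] to be the alternant of [l + rho] (the
   Weyl character formula).

   On the other side, if [z] are the eigenvalues of [g], Cayley-Hamilton
   expresses the powers of [g] in the left-hand side through 1, g, ..., g^r; the
   determinant of the coefficients times [V] is again the alternant of
   [l + rho], so it equals the character at diag(z), and hence at [g] since the
   character of a triangular matrix only depends on its diagonal. *)

(** * Polynomial identities read off from values, and derivatives along lines *)

Section PolynomialIdentities.
Variable K : numFieldType.

(** The product [p * q] vanishes everywhere, and characteristic zero supplies enough distinct points
    [0, 1, 2, ...] to exceed its degree. This is the density argument that carries identities over
    from generic parameters to all of them. *)
Lemma horner_eq0_on_nonroots (p q : {poly K}) :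
  q != 0 -> (forall t, q.[t] != 0 -> p.[t] = 0) -> p = 0.
Proof.
move=> q0 pq; apply/eqP; apply: contraT => p0.
have pq0 : p * q != 0 by rewrite mulf_neq0.
have /(max_poly_roots pq0) : all (root (p * q)) [seq i%:R | i <- iota 0 (size (p * q))].
  apply/allP => t _; rewrite rootE hornerM mulf_eq0.
  by have [_|/pq->] := eqVneq q.[t] 0; rewrite ?eqxx ?orbT.
rewrite size_map size_iota ltnn => /(_ _) -> //.
rewrite map_inj_uniq ?iota_uniq // => i j /eqP.
by rewrite Num.Theory.eqr_nat => /eqP.
Qed.

Lemma horner_eq0 (p : {poly K}) : (forall t, p.[t] = 0) -> p = 0.
Proof. by move=> p0; apply: (@horner_eq0_on_nonroots p 1); rewrite ?oner_neq0. Qed.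

Lemma eq_horner (p q : {poly K}) : (forall t, p.[t] = q.[t]) -> p = q.
Proof.
move=> pq; apply/eqP; rewrite -subr_eq0; apply/eqP/horner_eq0 => t.
by rewrite hornerD hornerN pq subrr.
Qed.

Lemma eq_poly_mx_on_nonroots m n (q : {poly K}) (A B : 'M[{poly K}]_(m, n)) :
  q != 0 ->
  (forall t, q.[t] != 0 -> map_mx (horner_eval t) A = map_mx (horner_eval t) B) ->
  A = B.
Proof.
move=> q0 AB; apply/matrixP=> i j; apply/eqP; rewrite -subr_eq0; apply/eqP.
apply: horner_eq0_on_nonroots q0 _ => t /AB /matrixP/(_ i j).
by rewrite !mxE /horner_eval hornerD hornerN => ->; rewrite subrr.
Qed.

Lemma eq_poly_mx m n (A B : 'M[{poly K}]_(m, n)) :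
  (forall t, map_mx (horner_eval t) A = map_mx (horner_eval t) B) -> A = B.
Proof.
by move=> AB; apply: (@eq_poly_mx_on_nonroots _ _ 1); rewrite ?oner_neq0.
Qed.

Lemma coef1M (R : comNzRingType) (p q : {poly R}) :
  (p * q)`_1 = p`_0 * q`_1 + p`_1 * q`_0.
Proof. by rewrite coefM !big_ord_recl big_ord0 addr0. Qed.

Lemma map_coef1_mulmx (R : comNzRingType) m n p (A : 'M[{poly R}]_(m, n))
    (B : 'M[{poly R}]_(n, p)) :
  map_mx (coefp 1) (A *m B)
  = map_mx (coefp 0) A *m map_mx (coefp 1) B
    + map_mx (coefp 1) A *m map_mx (coefp 0) B.
Proof.
apply/matrixP=> i j; rewrite !mxE /= coef_sum -big_split /=.
by apply: eq_bigr => k _; rewrite !mxE coef1M.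
Qed.

Section Mpoly.
Variable n : nat.
Implicit Types (p q : {mpoly K[n]}) (x y z : 'I_n -> K).

Lemma mpoly_ring_ind (Q : {mpoly K[n]} -> Prop) :
  (forall c, Q c%:MP) -> (forall i, Q 'X_i) ->
  (forall p q, Q p -> Q q -> Q (p + q)) ->
  (forall p q, Q p -> Q q -> Q (p * q)) -> forall p, Q p.
Proof.
move=> QC QX QD QM p; rewrite [p]mpolyE; apply: big_ind => [||m _] //.
  by rewrite -mpolyC0.
rewrite -mul_mpolyC mpolyXE_id; apply: (QM) => //.
apply: big_ind => [||i _] //; first by rewrite -mpolyC1.
by elim: (m i) => [|k IH]; rewrite ?expr0 -?mpolyC1 // exprS; apply: QM.
Qed.

Lemma horner_mmap (G : 'I_n -> {poly K}) p t :
  (mmap polyC G p).[t] = p.@[fun k => (G k).[t]].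
Proof.
elim/mpoly_ring_ind: p => [c|i|p q IHp IHq|p q IHp IHq].
- by rewrite mmapC hornerC mevalC.
- by rewrite mmapX mmap1U mevalXU.
- by rewrite !raddfD /= hornerD IHp IHq.
- by rewrite !rmorphM /= hornerM IHp IHq.
Qed.

Definition line x y : 'I_n -> {poly K} := fun k => (x k)%:P + 'X * (y k)%:P.

Lemma horner_line x y t k : (line x y k).[t] = x k + t * y k.
Proof. by rewrite /line !hornerE. Qed.

Lemma coef0_mmap_line p x y : (mmap polyC (line x y) p)`_0 = p.@[x].
Proof.
rewrite -horner_coef0 horner_mmap; apply: meval_eq => k.
by rewrite horner_line mul0r addr0.
Qed.

Lemma mderivXE i j : ('X_i)^`M(j) = (i == j)%:R%:MP :> {mpoly K[n]}.
Proof.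
rewrite mderivX mnm1E; have [<-|_] := eqVneq i j; last by rewrite scale0r mpolyC0.
have -> : (U_(i) - U_(i) = 0)%MM by apply/mnmP => k; rewrite mnmBE subnn mnm0E.
by rewrite mpolyX0 scale1r mpolyC1.
Qed.

(** Both sides obey the Leibniz rule, so constants and variables suffice. Every differentiation of a
    representation below is thereby the extraction of a linear coefficient. *)
Lemma coef1_mmap_line p x y :
  (mmap polyC (line x y) p)`_1 = \sum_k p^`M(k).@[x] * y k.
Proof.
elim/mpoly_ring_ind: p => [c|i|p q IHp IHq|p q IHp IHq].
- by rewrite mmapC coefC big1 // => k _; rewrite mderivC meval0 mul0r.
- rewrite mmapX mmap1U /line coefD coefC add0r coefXM coefC /=.
  rewrite (bigD1 i) //= mderivXE mevalC eqxx mul1r big1 ?addr0 // => k /negPf ki.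
  by rewrite mderivXE mevalC eq_sym ki mul0r.
- rewrite rmorphD coefD IHp IHq -big_split /=; apply: eq_bigr => k _.
  by rewrite mderivD mevalD mulrDl.
- rewrite rmorphM coef1M !coef0_mmap_line IHp IHq mulr_sumr mulr_suml -big_split /=.
  apply: eq_bigr => k _.
  by rewrite mderivM mevalD !mevalM mulrDl mulrA addrC mulrAC.
Qed.

(** Taylor expansion at the origin: each iterated derivative again vanishes at every point, being a
    linear coefficient along lines, and the [m]-th one has constant coefficient [m!] times that of
    [p] at [m], with [m!] nonzero in characteristic zero. *)
Lemma meval_eq0 p : (forall x, p.@[x] = 0) -> p = 0.
Proof.
move=> p0; apply/mpolyP => m; rewrite mcoeff0.
have pm0 : forall x, p^`M[m].@[x] = 0.
  rewrite mderivm_foldr; elim: (flatten _) => //= i s IH x.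
  have /polyP/(_ 1%N) : mmap polyC (line x (fun k => (k == i)%:R)) (foldr (@mderiv n K) p s) = 0.
    by apply: horner_eq0 => t; rewrite horner_mmap IH.
  rewrite coef1_mmap_line coef0 (bigD1 i) //= eqxx mulr1 big1 ?addr0 //.
  by move=> j /negPf->; rewrite mulr0.
have := pm0 (fun=> 0); rewrite mevalE.
set q := p^`M[m]; move=> q0.
have {q0} : q@_0%MM = 0.
  move: q0; have [q0|q0] := boolP (0%MM \in msupp q); last first.
    by move=> _; apply: memN_msupp_eq0.
  rewrite (bigD1_seq _ q0) ?msupp_uniq //= big1 ?mulr1.
    rewrite big1_seq ?addr0 // => m' /andP[m'0 _].
    have [i mi|mi] := pickP (fun i => m' i != 0%N).
      by rewrite (bigD1 i) //= expr0n (negPf mi) mul0r mulr0.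
    case/eqP: m'0; apply/mnmP => i; rewrite mnm0E; apply/eqP.
    by move/(_ i): mi => /negbFE.
  by move=> i _; rewrite mnm0E expr0.
rewrite /q mcoeff_mderivm addm0 => /eqP.
rewrite -mulr_natr mulf_eq0 => /orP[/eqP//|].
rewrite Num.Theory.pnatr_eq0 -leqn0 leqNgt; case/negP.
by apply: prodn_gt0 => i; rewrite ffactnn fact_gt0.
Qed.

Lemma eq_meval p q : (forall x, p.@[x] = q.@[x]) -> p = q.
Proof.
move=> pq; apply/eqP; rewrite -subr_eq0; apply/eqP/meval_eq0 => x.
by rewrite mevalB pq subrr.
Qed.

Lemma eq_meval_on (s p q : {mpoly K[n]}) : s != 0 ->
  (forall x, s.@[x] != 0 -> p.@[x] = q.@[x]) -> p = q.
Proof.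
move=> s0 pq; apply: (mulIf s0); apply: eq_meval => x; rewrite !mevalM.
by have [->|/pq->//] := eqVneq s.@[x] 0; rewrite !mulr0.
Qed.

(** The invariant vector field of the torus in direction [i], diagonal on monomials; the sum of the
    squares of these fields is the Laplacian. *)
Definition euler (i : 'I_n) p : {mpoly K[n]} := 'X_i * p^`M(i).

Lemma mcoeff_euler i p m : (euler i p)@_m = p@_m *+ m i.
Proof.
rewrite /euler mulrC; have [mi|mi] := posnP (m i).
  rewrite mi mulr0n; apply: memN_msupp_eq0; apply/negP.
  rewrite (perm_mem (msuppMX _ _)) => /mapP[m' _ /mnmP/(_ i)].
  by rewrite mnmDE mnm1E eqxx mi.
have {1 2}-> : m = (U_(i) + (m - U_(i)))%MM.
  by rewrite addmC submK // lep1mP -lt0n.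
by rewrite mcoeffMX mcoeff_deriv addmC mnmBE mnm1E eqxx subn1 prednK.
Qed.

Lemma euler_is_linear i : linear (euler i).
Proof.
by move=> a p q; rewrite /euler mderivD mderivZ mulrDr scalerAr.
Qed.

HB.instance Definition _ i :=
  GRing.isLinear.Build K {mpoly K[n]} {mpoly K[n]} _ (euler i)
    (euler_is_linear i).

Lemma eulerM i p q : euler i (p * q) = euler i p * q + p * euler i q.
Proof.
by rewrite /euler mderivM mulrDr; congr (_ + _); [exact: mulrA | exact: mulrCA].
Qed.

End Mpoly.
End PolynomialIdentities.

(** * Polynomial representations of the matrix monoid and their differentials *)

Section PolynomialRepresentations.
Variable K : numFieldType.

Lemma map_hornerC m n t (A : 'M[K]_(m, n)) :
  map_mx (horner_eval t) (map_mx polyC A) = A.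
Proof. by apply/matrixP=> i j; rewrite !mxE /horner_eval hornerC. Qed.

Lemma map_horner_scale m n t (p : {poly K}) (A : 'M[{poly K}]_(m, n)) :
  map_mx (horner_eval t) (p *: A) = p.[t] *: map_mx (horner_eval t) A.
Proof. by rewrite map_mxZ. Qed.

Lemma map_coef0_horner m n (A : 'M[{poly K}]_(m, n)) :
  map_mx (coefp 0) A = map_mx (horner_eval 0) A.
Proof. by apply/matrixP=> i j; rewrite !mxE /horner_eval horner_coef0. Qed.

Lemma map_coef1C m n (A : 'M[K]_(m, n)) : map_mx (coefp 1) (map_mx polyC A) = 0.
Proof. by apply/matrixP=> i j; rewrite !mxE /= coefC. Qed.

Lemma map_coef0C m n (A : 'M[K]_(m, n)) : map_mx (coefp 0) (map_mx polyC A) = A.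
Proof. by rewrite map_coef0_horner map_hornerC. Qed.

Definition mxline n (g Y : 'M[K]_n) : 'M[{poly K}]_n :=
  map_mx polyC g + 'X *: map_mx polyC Y.

Lemma horner_mxline n (g Y : 'M[K]_n) t :
  map_mx (horner_eval t) (mxline g Y) = g + t *: Y.
Proof. by apply/matrixP=> i j; rewrite !mxE /horner_eval !hornerE. Qed.

Lemma mul_mxline n (g Y h : 'M[K]_n) :
  mxline g Y *m map_mx polyC h = mxline (g *m h) (Y *m h).
Proof. by rewrite mulmxDl -scalemxAl -!map_mxM. Qed.

Lemma mul_mx_line n (g Y h : 'M[K]_n) :
  map_mx polyC h *m mxline g Y = mxline (h *m g) (h *m Y).
Proof. by rewrite mulmxDr -scalemxAr -!map_mxM. Qed.

(** This determinant is the characteristic polynomial of [- g]. Hence [g + t] is invertible for all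
    but finitely many [t], and any [g] is a limit of invertible matrices along a line. *)
Lemma det_mxline1_neq0 n (g : 'M[K]_n) : \det (mxline g 1%:M) != 0.
Proof.
have -> : mxline g 1%:M = char_poly_mx (- g).
  rewrite /mxline /char_poly_mx map_mxN opprK addrC map_mx1.
  by rewrite scalemx1.
by rewrite -/(char_poly _) monic_neq0 // char_poly_monic.
Qed.

Lemma mmap_ext n (R : nzRingType) (S : nzRingType) (f : R -> S) (h1 h2 : 'I_n -> S) p :
  h1 =1 h2 -> mmap f h1 p = mmap f h2 p.
Proof.
by move=> h12; apply: eq_bigr => m _; congr (_ * _); apply: mmap1_eq.
Qed.

Definition mx_path n (p : {mpoly K[n * n]}) (G : 'M[{poly K}]_n) : {poly K} :=
  mmap polyC (fun k => mxvec G 0 k) p.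

Lemma horner_mx_path n (p : {mpoly K[n * n]}) (G : 'M[{poly K}]_n) t :
  (mx_path p G).[t] = mx_eval p (map_mx (horner_eval t) G).
Proof.
rewrite /mx_path horner_mmap; apply: meval_eq => k.
by rewrite -map_mxvec mxE.
Qed.

Variables (n d : nat) (P : 'M[{mpoly K[n * n]}]_d).

Definition pev (g : 'M[K]_n) : 'M[K]_d := map_mx (fun p => mx_eval p g) P.

Definition ppath (G : 'M[{poly K}]_n) : 'M[{poly K}]_d :=
  map_mx (fun p => mx_path p G) P.

Lemma horner_ppath G t :
  map_mx (horner_eval t) (ppath G) = pev (map_mx (horner_eval t) G).
Proof.
by apply/matrixP=> i j; rewrite !mxE /horner_eval horner_mx_path.
Qed.

Lemma ppathC g : ppath (map_mx polyC g) = map_mx polyC (pev g).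
Proof.
by apply: eq_poly_mx => t; rewrite horner_ppath !map_hornerC.
Qed.

Definition dpev (g Y : 'M[K]_n) : 'M[K]_d := map_mx (coefp 1) (ppath (mxline g Y)).

Lemma dpevE g Y : dpev g Y =
  \matrix_(a, b) \sum_k mx_eval (P a b)^`M(k) g * mxvec Y 0 k.
Proof.
apply/matrixP=> a b; rewrite !mxE /= /mx_path.
rewrite (@mmap_ext _ _ _ _ _ (line (fun k => mxvec g 0 k) (fun k => mxvec Y 0 k))).
  exact: coef1_mmap_line.
by case/mxvec_indexP=> i j; rewrite /line !mxvecE !mxE.
Qed.

Lemma dpev_is_linear g : linear (dpev g).
Proof.
move=> s X Y; rewrite !dpevE; apply/matrixP=> a b; rewrite !mxE.
rewrite mulr_sumr -big_split /=; apply: eq_bigr => k _.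
by rewrite linearP !mxE mulrDr mulrCA.
Qed.

HB.instance Definition _ g :=
  GRing.isLinear.Build K 'M[K]_n 'M[K]_d _ (dpev g) (dpev_is_linear g).

Lemma dpevZ g a Y : dpev g (a *: Y) = a *: dpev g Y.
Proof. by rewrite linearZ. Qed.

Definition dpath (G : 'M[{poly K}]_n) (Y : 'M[K]_n) : 'M[{poly K}]_d :=
  \matrix_(a, b) \sum_k mx_path (P a b)^`M(k) G * (mxvec Y 0 k)%:P.

Lemma horner_dpath G Y t :
  map_mx (horner_eval t) (dpath G Y) = dpev (map_mx (horner_eval t) G) Y.
Proof.
rewrite dpevE; apply/matrixP=> a b; rewrite !mxE /horner_eval horner_sum.
by apply: eq_bigr => k _; rewrite hornerM hornerC horner_mx_path.
Qed.

(** Adding [t] times the identity to both arguments makes them invertible for almost all [t]; the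
    resulting polynomial identity is then specialized at [t = 0]. *)
Lemma pev_morph :
  {in unitmx &, {morph pev : g h / g *m h}} -> {morph pev : g h / g *m h}.
Proof.
move=> pevM_unit g h; pose G := mxline g 1%:M; pose H := mxline h 1%:M.
have [G0 H0] := (horner_mxline g 1%:M 0, horner_mxline h 1%:M 0).
rewrite scale0r addr0 in G0; rewrite scale0r addr0 in H0.
suff /(congr1 (map_mx (horner_eval 0))) : ppath (G *m H) = ppath G *m ppath H.
  by rewrite map_mxM !horner_ppath map_mxM G0 H0.
apply: (@eq_poly_mx_on_nonroots _ _ _ (\det G * \det H)).
  by rewrite mulf_neq0 // det_mxline1_neq0.
move=> t; rewrite hornerM mulf_eq0 negb_or => /andP[Gt Ht].
by rewrite map_mxM !horner_ppath map_mxM pevM_unit // unitmxE det_map_mx unitfE.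
Qed.

Hypothesis pevM : {morph pev : g h / g *m h}.

Lemma ppathM : {morph ppath : G H / G *m H}.
Proof.
by move=> G H; apply: eq_poly_mx => t; rewrite map_mxM !horner_ppath map_mxM pevM.
Qed.

Lemma pev_dpev g h Y : pev h *m dpev g Y = dpev (h *m g) (h *m Y).
Proof.
rewrite /dpev -mul_mx_line ppathM map_coef1_mulmx ppathC map_coef0C map_coef1C.
by rewrite mul0mx addr0.
Qed.

Lemma dpev_pev g h Y : dpev g Y *m pev h = dpev (g *m h) (Y *m h).
Proof.
rewrite /dpev -mul_mxline ppathM map_coef1_mulmx ppathC map_coef0C map_coef1C.
by rewrite mulmx0 add0r.
Qed.

(* The differential of [P] at the identity. *)
Definition lie (X : 'M[K]_n) : 'M[K]_d := dpev 1%:M X.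

HB.instance Definition _ := GRing.Linear.copy lie (dpev 1%:M).

Lemma lieB X Y : lie (X - Y) = lie X - lie Y.
Proof. by rewrite linearB. Qed.

Lemma lie_sumZ (I : finType) (a : I -> K) (X : I -> 'M[K]_n) :
  lie (\sum_i a i *: X i) = \sum_i a i *: lie (X i).
Proof. by rewrite linear_sum; apply: eq_bigr => i _; rewrite linearZ. Qed.

Lemma pev_lie g X : pev g *m lie X = dpev g (g *m X).
Proof. by rewrite pev_dpev mulmx1. Qed.

Lemma lie_pev g X : lie X *m pev g = dpev g (X *m g).
Proof. by rewrite dpev_pev mul1mx. Qed.

(** By equivariance, the commutator of [pev P (1 + t X)] with [lie Y] is [t] times the differential
    at [1 + t X] in direction [X Y - Y X]. The coefficients of [t] on both sides give the
    bracket. *)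
Lemma lie_bracket X Y : lie X *m lie Y - lie Y *m lie X = lie (X *m Y - Y *m X).
Proof.
pose G := mxline 1%:M X; pose D := dpath G (X *m Y - Y *m X).
suff GD : ppath G *m map_mx polyC (lie Y) - map_mx polyC (lie Y) *m ppath G = 'X *: D.
  have -> : lie X *m lie Y = map_mx (coefp 1) (ppath G *m map_mx polyC (lie Y)).
    by rewrite map_coef1_mulmx map_coef0C map_coef1C mulmx0 [RHS]add0r.
  have -> : lie Y *m lie X = map_mx (coefp 1) (map_mx polyC (lie Y) *m ppath G).
    by rewrite map_coef1_mulmx map_coef0C map_coef1C mul0mx [RHS]addr0.
  have -> : lie (X *m Y - Y *m X) = map_mx (coefp 0) D.
    by rewrite map_coef0_horner horner_dpath horner_mxline scale0r addr0.
  rewrite -map_mxB GD.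
  by apply/matrixP=> a b; rewrite mxE [in RHS]mxE [in LHS]mxE /= coefXM.
apply: eq_poly_mx => t; rewrite map_mxB !map_mxM map_hornerC horner_ppath.
rewrite map_horner_scale hornerX horner_dpath horner_mxline.
rewrite pev_lie lie_pev -raddfB -linearZ; congr dpev.
rewrite mulmxDl mulmxDr mul1mx mulmx1 -scalemxAl -scalemxAr.
by rewrite opprD addrACA subrr add0r scalerBr.
Qed.

End PolynomialRepresentations.

(** * The character on the torus and the radial part of the Casimir operator *)

Section TorusAndCasimir.
Variables (K : numFieldType) (n d : nat) (P : 'M[{mpoly K[n * n]}]_d).
Hypothesis pev1 : pev P 1%:M = 1%:M.
Hypothesis pevM : {morph pev P : g h / g *m h}.

Definition dz (z : 'I_n -> K) : 'M[K]_n := diag_mx (\row_i z i).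

Lemma meval_mmap m k (h : 'I_m -> {mpoly K[k]}) (p : {mpoly K[m]}) z :
  (mmap (@mpolyC k K) h p).@[z] = p.@[fun i => (h i).@[z]].
Proof.
elim/mpoly_ring_ind: p => [c|i|p q IHp IHq|p q IHp IHq].
- by rewrite mmapC !mevalC.
- by rewrite mmapX mmap1U mevalXU.
- by rewrite !raddfD /= IHp IHq.
- by rewrite !rmorphM /= IHp IHq.
Qed.

Definition on_torus (p : {mpoly K[n * n]}) : {mpoly K[n]} :=
  mmap (@mpolyC n K) (fun k => mxvec (diag_mx (\row_i 'X_i)) 0 k) p.

Lemma meval_on_torus p z : (on_torus p).@[z] = mx_eval p (dz z).
Proof.
rewrite /on_torus meval_mmap; apply: meval_eq.
case/mxvec_indexP=> i j; rewrite !mxvecE !mxE.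
by case: eqP => _; rewrite ?mulr1n ?mulr0n ?mevalXU ?meval0.
Qed.

Definition torus : 'M[{mpoly K[n]}]_d := map_mx on_torus P.

Lemma meval_torus z : map_mx (meval z) torus = pev P (dz z).
Proof. by apply/matrixP=> a b; rewrite !mxE meval_on_torus. Qed.

(** Left multiplication of [dz z] by [1 + t E_ii] moves only the coordinate [z i], with velocity
    [z i]; the derivative of the torus matrix along this line is its Euler derivative. *)
Lemma lie_torus i :
  map_mx (@mpolyC n K) (lie P (delta_mx i i)) *m torus = map_mx (euler i) torus.
Proof.
apply/matrixP=> a b; apply: eq_meval => z.
transitivity ((lie P (delta_mx i i) *m pev P (dz z)) a b).
  rewrite -meval_torus !mxE raddf_sum; apply: eq_bigr => k _.
  by rewrite !mxE /= mevalM mevalC.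
rewrite lie_pev // [in RHS]mxE /euler mevalM mevalXU /dpev mxE /=.
pose y k := z i * (k == i)%:R.
transitivity ((mmap polyC (line z y) (torus a b))`_1); last first.
  rewrite coef1_mmap_line (bigD1 i) //= big1 ?addr0 => [|j /negPf ji].
    by rewrite /y eqxx mulr1 mulrC.
  by rewrite /y ji !mulr0.
congr (nth 0 (polyseq _) 1); apply: eq_horner => t.
rewrite [torus a b]mxE [ppath _ _ a b]mxE !horner_mmap meval_mmap.
apply: meval_eq.
case/mxvec_indexP=> k l; rewrite !mxvecE !mxE.
rewrite (bigD1 i) //= big1 => [|j /negPf ji]; last first.
  by rewrite mxE ji andbF mul0r.
rewrite !mxE !eqxx andbT addr0 !hornerE.
have [<-|kl] := eqVneq k l; rewrite ?mulr1n ?mulr0n ?mevalXU ?meval0 /=.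
  rewrite horner_line /y eq_sym; have [->|_] := eqVneq k i.
    by rewrite mulr1n !mulr1.
  by rewrite mulr0n !mulr0.
rewrite add0r; have [ki|_] := eqVneq k i; last by rewrite mulr0 mul0r.
by rewrite -ki (negPf kl) mulr0n mulr0.
Qed.

Definition character : {mpoly K[n]} := \tr torus.

Lemma meval_character z : character.@[z] = \tr (pev P (dz z)).
Proof.
rewrite -meval_torus /character /mxtrace raddf_sum /=.
by apply: eq_bigr => a _; rewrite [RHS]mxE.
Qed.

Lemma lie_meval_torus i (B : 'M[{mpoly K[n]}]_d) z :
  map_mx (@mpolyC n K) (lie P (delta_mx i i)) *m B = map_mx (euler i) B ->
  lie P (delta_mx i i) *m map_mx (meval z) B = map_mx (meval z) (map_mx (euler i) B).
Proof.
move=> <-; apply/matrixP=> a b; rewrite [LHS]mxE [RHS]mxE [in RHS]mxE raddf_sum /=.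
by apply: eq_bigr => k _; rewrite mevalM [map_mx _ _ a k]mxE mevalC [map_mx _ _ k b]mxE.
Qed.

Lemma map_euler_scalar_mul i (A : 'M[K]_d) (B : 'M[{mpoly K[n]}]_d) :
  map_mx (euler i) (map_mx (@mpolyC n K) A *m B)
  = map_mx (@mpolyC n K) A *m map_mx (euler i) B.
Proof.
apply/matrixP=> a b; rewrite [LHS]mxE !mxE raddf_sum /=.
by apply: eq_bigr => k _; rewrite !mxE !mul_mpolyC linearZ.
Qed.

Lemma trace_map_euler i (B : 'M[{mpoly K[n]}]_d) z :
  \tr (map_mx (meval z) (map_mx (euler i) B)) = (euler i (\tr B)).@[z].
Proof.
rewrite /mxtrace !raddf_sum /=; apply: eq_bigr => a _.
by rewrite !mxE.
Qed.

Lemma trace_lie_torus i z :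
  \tr (lie P (delta_mx i i) *m pev P (dz z)) = (euler i character).@[z].
Proof.
by rewrite -meval_torus lie_meval_torus ?lie_torus // trace_map_euler.
Qed.

Lemma trace_lie2_torus i z :
  \tr (lie P (delta_mx i i) *m lie P (delta_mx i i) *m pev P (dz z))
  = (euler i (euler i character)).@[z].
Proof.
rewrite -mulmxA -meval_torus lie_meval_torus ?lie_torus //.
rewrite lie_meval_torus; last by rewrite -map_euler_scalar_mul lie_torus.
rewrite trace_map_euler; congr meval; congr euler.
by rewrite /character /mxtrace raddf_sum; apply: eq_bigr => a _; rewrite [LHS]mxE.
Qed.

Lemma dz_delta z i j : dz z *m delta_mx i j = z i *: delta_mx i j :> 'M_n.
Proof.
apply/matrixP=> k l; rewrite mul_diag_mx !mxE.
by case: eqP => [->|_]; rewrite ?mulr0.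
Qed.

Lemma delta_dz z i j : delta_mx i j *m dz z = z j *: delta_mx i j :> 'M_n.
Proof.
apply/matrixP=> k l; rewrite mul_mx_diag !mxE mulrC.
by case: (l =P j) => [->|_]; rewrite ?andbF ?mulr0.
Qed.

(** Moving [F] past [T] and around the trace gives [b tr(EFT) = a tr(FET)], which is subtracted from
    [a tr(EFT)]. *)
Lemma trace_commutator (E F T : 'M[K]_d) (a b : K) :
  b *: (F *m T) = a *: (T *m F) ->
  (a - b) * \tr (E *m F *m T) = a * \tr ((E *m F - F *m E) *m T).
Proof.
move=> FT; have cyc : b * \tr (E *m F *m T) = a * \tr (F *m E *m T).
  rewrite -mulmxA -mxtraceZ scalemxAr FT -scalemxAr mxtraceZ mulmxA.
  by rewrite mxtrace_mulC mulmxA.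
by rewrite mulrBl cyc -mulrBr -raddfB -mulmxBl.
Qed.

(** The torus element commutes with the root vector of [delta_mx j i] up to a scalar, so only the
    bracket of the two root vectors is left, a difference of diagonal elements. *)
Lemma trace_lie_root z i j : i != j ->
  (z i - z j) * \tr (lie P (delta_mx i j) *m lie P (delta_mx j i) *m pev P (dz z))
  = z i * ((euler i character).@[z] - (euler j character).@[z]).
Proof.
move=> ij; rewrite trace_commutator; last first.
  rewrite (lie_pev pevM) (pev_lie pevM) dz_delta delta_dz !dpevZ.
  by rewrite !scalerA mulrC.
rewrite (lie_bracket pevM) !mul_delta_mx lieB mulmxBl raddfB /=.
by congr (_ * (_ - _)); apply: trace_lie_torus.
Qed.

Lemma lie_conj g X : g \in unitmx ->
  pev P g *m lie P X = lie P (g *m X *m invmx g) *m pev P g.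
Proof. by move=> gu; rewrite (pev_lie pevM) (lie_pev pevM) mulmxKV. Qed.

(* The Casimir element, plus a central term which makes the eigenvalue below
   equal to [|l + rho|^2 - |rho|^2] for [rho = (n - 1, .., 1, 0)]. *)
Definition casimir : 'M[K]_d :=
  \sum_i \sum_j lie P (delta_mx i j) *m lie P (delta_mx j i)
  + n.-1%:R *: lie P 1%:M.

Lemma conj_delta (g h : 'M[K]_n) i j :
  g *m delta_mx i j *m h
  = \sum_p (g p.1 i * h j p.2) *: delta_mx p.1 p.2.
Proof.
rewrite -(pair_bigA _ (fun a b => (g a i * h j b) *: delta_mx a b)) /=.
rewrite [LHS]matrix_sum_delta; apply: eq_bigr => a _; apply: eq_bigr => b _.
congr (_ *: _); rewrite mxE (bigD1 j) //= big1 => [|k /negPf kj].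
  rewrite addr0; congr (_ * _); rewrite mxE (bigD1 i) //= big1 => [|k /negPf ki].
    by rewrite mxE !eqxx mulr1 addr0.
  by rewrite mxE ki mulr0.
by rewrite mxE big1 ?mul0r // => l _; rewrite mxE kj andbF mulr0.
Qed.

(** After conjugating every factor by [g], the coefficient of [E p *m E q] is a product of two
    entries of [g *m invmx g], so only the original dual pairs survive. *)
Lemma casimir_comm g : g \in unitmx -> pev P g *m casimir = casimir *m pev P g.
Proof.
move=> gu; rewrite /casimir mulmxDr mulmxDl -scalemxAr -scalemxAl.
congr (_ + _ *: _); last by rewrite (pev_lie pevM) (lie_pev pevM) mulmx1 mul1mx.
pose h := invmx g; pose E (p : 'I_n * 'I_n) := lie P (delta_mx p.1 p.2).
transitivity ((\sum_i \sum_j (\sum_p (g p.1 i * h j p.2) *: E p)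
   *m (\sum_q (g q.1 j * h i q.2) *: E q)) *m pev P g).
  rewrite mulmx_sumr mulmx_suml; apply: eq_bigr => i _.
  rewrite mulmx_sumr mulmx_suml; apply: eq_bigr => j _.
  rewrite mulmxA (lie_conj _ gu) -mulmxA (lie_conj _ gu) mulmxA.
  by rewrite !conj_delta !lie_sumZ.
congr (_ *m _).
transitivity (\sum_p \sum_q
    ((g *m h) p.1 q.2 * (g *m h) q.1 p.2) *: (E p *m E q)).
  under eq_bigr do under eq_bigr do
    (rewrite mulmx_suml; under eq_bigr do rewrite mulmx_sumr).
  under eq_bigr do rewrite exchange_big; rewrite exchange_big /=.
  apply: eq_bigr => p _.
  under eq_bigr do rewrite exchange_big; rewrite exchange_big /=.
  apply: eq_bigr => q _; rewrite !mxE big_distrlr /= scaler_suml.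
  apply: eq_bigr => i _; rewrite scaler_suml; apply: eq_bigr => j _.
  rewrite -scalemxAl -scalemxAr scalerA; congr (_ *: _).
  by rewrite mulrACA [RHS]mulrACA; congr (_ * _); rewrite mulrC.
rewrite mulmxV // [RHS]pair_bigA /=; apply: eq_bigr => -[i j] _.
rewrite (bigD1 (j, i)) //= big1 ?addr0 => [|[k l]].
  by rewrite !mxE !eqxx mulr1 scale1r.
rewrite xpair_eqE negb_and !mxE /= => /orP[] /negPf e.
  by rewrite e mulr0 scale0r.
by rewrite eq_sym e mul0r scale0r.
Qed.

Variables (l : 'X_{1..n}) (v : 'cV[K]_d).
Hypothesis v_torus : forall z, (forall i, z i != 0) ->
  pev P (dz z) *m v = (\prod_i z i ^+ l i) *: v.
Hypothesis v_unip : forall u, upper_unitriangular u -> pev P u *m v = v.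

Lemma prodX_neq0 : \prod_i 'X_i != 0 :> {mpoly K[n]}.
Proof.
apply/prodf_neq0 => i _; apply/eqP => /(congr1 (mcoeff U_(i))).
by rewrite mcoeffXU eqxx mcoeff0 => /eqP; rewrite oner_eq0.
Qed.

(** The weight condition is known only for nonzero coordinates; as an identity of polynomials it
    extends to the whole of affine space. *)
Lemma torus_hwv :
  torus *m map_mx (@mpolyC n K) v = 'X_[l] *: map_mx (@mpolyC n K) v.
Proof.
apply/matrixP=> a b; apply: (eq_meval_on prodX_neq0) => z.
rewrite rmorph_prod /= => /prodf_neq0 z0.
have /v_torus/matrixP/(_ a b) : forall i, z i != 0.
  by move=> i; have := z0 i isT; rewrite mevalXU.
rewrite -meval_torus [in RHS]mxE => e; rewrite [in RHS]mxE mevalM mevalX.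
rewrite [map_mx _ _ a b]mxE mevalC -e mxE [in RHS]mxE raddf_sum /=.
by apply: eq_bigr => k _; rewrite mevalM [map_mx _ v _ _]mxE mevalC [in RHS]mxE.
Qed.

Lemma pev_dz_hwv z : pev P (dz z) *m v = (\prod_i z i ^+ l i) *: v.
Proof.
have /(congr1 (map_mx (meval z))) := torus_hwv.
rewrite map_mxM [in RHS]map_mxZ meval_torus /= mevalX => e.
have vE : map_mx (meval z) (map_mx (@mpolyC n K) v) = v.
  by apply/matrixP=> a b; rewrite !mxE mevalC.
by rewrite vE in e.
Qed.

Lemma coef_expX1 k : (((1 + 'X) ^+ k : {poly K})`_0 = 1)
                      * (((1 + 'X) ^+ k : {poly K})`_1 = k%:R).
Proof.
elim: k => [|k IH]; first by rewrite expr0 !coefC.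
rewrite exprS coef1M coef0M !IH !coefD !coefC !coefX /= add0r addr0 !mul1r.
by rewrite -natr1.
Qed.

Lemma lie_diag_hwv i : lie P (delta_mx i i) *m v = (l i)%:R *: v.
Proof.
(* [1 + t E_ii] is diagonal, with [1 + t] as its [i]-th entry, so it scales [v] by [(1 + t) ^ l i];
   the linear coefficient of that power is [l i]. *)
have e : ppath P (mxline 1%:M (delta_mx i i)) *m map_mx polyC v
    = ((1 + 'X) ^+ l i) *: map_mx polyC v.
  apply: eq_poly_mx => t.
  rewrite map_horner_scale map_mxM !map_hornerC horner_ppath horner_mxline.
  pose z k := 1 + t * (k == i)%:R.
  have -> : 1%:M + t *: delta_mx i i = dz z.
    apply/matrixP=> a b; rewrite !mxE /z; have [<-|ab] := eqVneq a b.
      by rewrite mulr1n andbb.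
    rewrite mulr0n add0r; have [ai|_] := eqVneq a i; last by rewrite mulr0.
    by rewrite -ai eq_sym (negPf ab) mulr0.
  rewrite pev_dz_hwv (bigD1 i) //= big1 => [|k /negPf ki].
    by rewrite /z eqxx !mulr1 !hornerE.
  by rewrite /z ki mulr0 addr0 expr1n.
have := congr1 (map_mx (coefp 1)) e.
rewrite map_coef1_mulmx map_coef1C mulmx0 map_coef0C add0r => ->.
by apply/matrixP=> a b; rewrite !mxE /= coefMC (coef_expX1 _).2.
Qed.

(** For every [t] the matrix [1 + t E_ij] is unitriangular and fixes [v], so there is no linear term
    in [t]. *)
Lemma lie_upper_hwv (i j : 'I_n) : (i < j)%N -> lie P (delta_mx i j) *m v = 0.
Proof.
move=> ij; have e : ppath P (mxline 1%:M (delta_mx i j)) *m map_mx polyC v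
    = map_mx polyC v.
  apply: eq_poly_mx => t; rewrite map_mxM !map_hornerC horner_ppath horner_mxline.
  apply: v_unip; split=> [a b ba|a]; rewrite !mxE.
    rewrite (_ : a == b = false) ?add0r; last by apply/eqP => e; rewrite e ltnn in ba.
    have [ai|_] := eqVneq a i; last by rewrite mulr0.
    have [bj|_] := eqVneq b j; last by rewrite mulr0.
    by move: ba; rewrite ai bj ltnNge (ltnW ij).
  rewrite eqxx; have [ai|_] := eqVneq a i; last by rewrite mulr0 addr0.
  have [aj|_] := eqVneq a j; last by rewrite mulr0 addr0.
  by move: ij; rewrite -ai -aj ltnn.
have := congr1 (map_mx (coefp 1)) e.
by rewrite map_coef1_mulmx map_coef1C mulmx0 map_coef0C add0r.
Qed.

Lemma sum_ltn_ord m (i : nat) : (\sum_(j < m) (i < j) = m - i.+1)%N.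
Proof. by elim: m => [|m IH]; rewrite ?big_ord0 // big_ord_recr /= IH; lia. Qed.

Lemma sum_gtn_ord m (i : nat) : (i <= m)%N -> (\sum_(j < m) (j < i) = i)%N.
Proof.
elim: m i => [|m IH] i im; first by rewrite big_ord0; lia.
rewrite big_ord_recr /=; case: (ltnP m i) => mi; last by rewrite IH // addn0.
have -> : i = m.+1 by lia.
rewrite (eq_bigr (fun=> 1%N)) ?sum1_card ?card_ord ?addn1 // => j _.
by rewrite ltnS (ltnW (ltn_ord j)).
Qed.

Definition casimir_value : K :=
  \sum_(i < n) ((l i)%:R ^+ 2 + 2 * (n.-1 - i)%:R * (l i)%:R).

Lemma casimir_hwv : casimir *m v = casimir_value *: v.
Proof.
pose a i : K := (l i)%:R.
(* The scalar by which the summand [(i, j)] acts on [v]. For [i > j] the raising operator acts first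
   and kills [v]; for [i < j] the factors are exchanged to reach that situation, at the cost of the
   bracket [E_ii - E_jj]. *)
pose t (i j : 'I_n) : K := (i == j)%:R * a i ^+ 2 + (i < j)%:R * (a i - a j).
have tE i j : lie P (delta_mx i j) *m lie P (delta_mx j i) *m v = t i j *: v.
  rewrite /t; case: (ltngtP i j) => ij.
  - have -> : (i == j) = false by apply: contraTF ij => /eqP->; rewrite ltnn.
    rewrite mul0r add0r mul1r -[X in X *m v](subrK (lie P (delta_mx j i) *m lie P (delta_mx i j))).
    rewrite (lie_bracket pevM) !mul_delta_mx lieB mulmxDl -mulmxA lie_upper_hwv //.
    by rewrite mulmx0 addr0 mulmxBl !lie_diag_hwv scalerBl.
  - have -> : (i == j) = false by apply: contraTF ij => /eqP->; rewrite ltnn.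
    by rewrite -mulmxA lie_upper_hwv // mulmx0 !mul0r addr0 scale0r.
  - rewrite (ord_inj ij).
    by rewrite eqxx mul0r mul1r addr0 -mulmxA lie_diag_hwv -scalemxAr lie_diag_hwv scalerA.
have -> : casimir *m v = (\sum_i \sum_j t i j + n.-1%:R * \sum_i a i) *: v.
  rewrite /casimir mulmxDl scalerDl mulmx_suml scaler_suml; congr (_ + _).
    apply: eq_bigr => i _; rewrite mulmx_suml scaler_suml; apply: eq_bigr => j _.
    exact: tE.
  rewrite -scalemxAl -scalerA mx1_sum_delta linear_sum mulmx_suml scaler_suml.
  by congr (_ *: _); apply: eq_bigr => i _; rewrite lie_diag_hwv.
congr (_ *: _); rewrite /casimir_value mulr_sumr.
(* Each [a i] is counted [n - i - 1] times positively and [i] times negatively; with the [n - 1] of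
   the central term this makes [2 (n - 1 - i)]. *)
have -> : \sum_i \sum_j t i j
    = \sum_i a i ^+ 2 + \sum_(i < n) (n - i.+1)%:R * a i - \sum_(i < n) i%:R * a i.
  rewrite -big_split -sumrB /=.
  transitivity (\sum_(i < n) (a i ^+ 2 + (n - i.+1)%:R * a i - \sum_(j < n) (i < j)%:R * a j)).
    apply: eq_bigr => i _; rewrite -sum_ltn_ord natr_sum mulr_suml.
    rewrite -addrA -sumrB /t big_split /=; congr (_ + _).
      rewrite (bigD1 i) //= eqxx mul1r big1 ?addr0 // => j ji.
      by rewrite eq_sym (negPf ji) mul0r.
    by apply: eq_bigr => j _; rewrite mulrBr.
  rewrite !sumrB; congr (_ - _); rewrite exchange_big; apply: eq_bigr => j _ /=.
  by rewrite -mulr_suml -natr_sum sum_gtn_ord // ltnW.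
rewrite -!big_split -sumrB -big_split /=; apply: eq_bigr => i _.
rewrite -[in RHS]/(a i) -!addrA; congr (_ + _).
have -> : (n - i.+1 = n.-1 - i)%N by have := ltn_ord i; lia.
have <- : (n.-1 - i)%:R + i%:R = n.-1%:R :> K.
  by rewrite -natrD subnK //; have := ltn_ord i; lia.
ring.
Qed.

Hypothesis v_neq0 : v != 0.
(** Irreducibility in dual form: the orbit of a nonzero vector spans the space, so an operator that
    kills the orbit is zero. *)
Hypothesis irr : forall (A : 'M[K]_d) (x : 'cV[K]_d), x != 0 ->
  (forall g, g \in unitmx -> A *m pev P g *m x = 0) -> A = 0.

(** The difference of the two sides commutes with the group and kills [v], hence kills the orbit of
    [v]. *)
Lemma casimir_scalar : casimir = casimir_value%:M.
Proof.
apply/eqP; rewrite -subr_eq0; apply/eqP; apply: irr v_neq0 _ => g gu.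
rewrite mulmxBl -(casimir_comm gu) mulmxBl -(mulmxA (pev P g)) casimir_hwv.
by rewrite mul_scalar_mx -scalemxAl -scalemxAr subrr.
Qed.

(** Both sides compute the trace of [casimir *m pev P (dz z)]: once with the scalar value of the
    Casimir operator, once term by term, the root terms being divided by [z i - z j]. *)
Lemma casimir_radial z : (forall i j, i != j -> z i != z j) ->
  casimir_value * character.@[z]
  = \sum_i (euler i (euler i character)).@[z]
    + \sum_i \sum_(j | j != i) z i / (z i - z j)
        * ((euler i character).@[z] - (euler j character).@[z])
    + n.-1%:R * \sum_i (euler i character).@[z].
Proof.
move=> zinj.
transitivity (\tr (casimir *m pev P (dz z))).
  by rewrite casimir_scalar mul_scalar_mx mxtraceZ meval_character.
rewrite /casimir mulmxDl raddfD /= -scalemxAl mxtraceZ; congr (_ + _ * _); last first.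
  rewrite mx1_sum_delta linear_sum mulmx_suml raddf_sum /=.
  by apply: eq_bigr => i _; apply: trace_lie_torus.
rewrite mulmx_suml raddf_sum -big_split /=; apply: eq_bigr => i _.
rewrite mulmx_suml raddf_sum (bigD1 i) //=; congr (_ + _).
  exact: trace_lie2_torus.
apply: eq_bigr => j ji; apply: (@mulfI _ (z i - z j)).
  by rewrite subr_eq0 zinj // eq_sym.
rewrite trace_lie_root; last by rewrite eq_sym.
by rewrite mulrA mulrCA divff ?mulr1 // subr_eq0 zinj // eq_sym.
Qed.
End TorusAndCasimir.

(** * Generic LU factorization along a polynomial path of matrices *)

Section LU.
Variable K : numFieldType.

Definition lower_unitriangular n (L : 'M[K]_n) : Prop :=
  (forall i j : 'I_n, (i < j)%N -> L i j = 0) /\ (forall i, L i i = 1).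

Definition upper_invertible n (U : 'M[K]_n) : Prop :=
  (forall i j : 'I_n, (j < i)%N -> U i j = 0) /\ (forall i, U i i != 0).

Lemma lower_unitriangular_block n (x : 'cV[K]_n) L :
  lower_unitriangular L ->
  @lower_unitriangular (1 + n) (block_mx 1%:M 0 x L).
Proof.
case=> L0 L1; split=> [i j|i]; last first.
  by case: (split_ordP i) => i' ->; rewrite ?block_mxEul ?block_mxEdr ?mxE ?ord1.
case: (split_ordP i) => i' ->; case: (split_ordP j) => j' -> /=.
- by rewrite !ord1 ltnn.
- by rewrite block_mxEur mxE.
- by rewrite !ord1.
- by rewrite ltn_add2l block_mxEdr => /L0.
Qed.

Lemma upper_invertible_block n s (x : 'rV[K]_n) r U :
  s != 0 -> r != 0 -> upper_invertible U ->
  @upper_invertible (1 + n) (block_mx s%:M x 0 (r *: U)).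
Proof.
move=> s0 r0 [U0 U1]; split=> [i j|i]; last first.
  case: (split_ordP i) => i' ->; rewrite ?block_mxEul ?block_mxEdr !mxE ?ord1.
    by rewrite mulr1n.
  by rewrite mulf_neq0.
case: (split_ordP i) => i' ->; case: (split_ordP j) => j' -> /=.
- by rewrite !ord1 ltnn.
- by rewrite !ord1.
- by rewrite block_mxEdl mxE.
- by rewrite ltn_add2l block_mxEdr mxE => /U0->; rewrite mulr0.
Qed.

Lemma block_LU n s (b : 'rV[K]_n) (c : 'cV[K]_n) (D L U : 'M[K]_n) :
  s != 0 -> s *: D - c *m b = L *m U ->
  block_mx s%:M b c D
  = block_mx 1%:M 0 (s^-1 *: c) L *m block_mx s%:M b 0 (s^-1 *: U).
Proof.
move=> s0 LU; rewrite mulmx_block !mul1mx !mul0mx !mulmx0 !addr0; congr block_mx.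
  by rewrite mul_mx_scalar scalerA mulfV // scale1r.
rewrite -scalemxAl -scalemxAr -scalerDr -LU addrC subrK.
by rewrite scalerA mulVf // scale1r.
Qed.

(* The induction clears the denominator of the Schur complement, which keeps
   it a polynomial matrix equal to the identity at 0. *)
Lemma LU_on_nonroots n (G : 'M[{poly K}]_n) :
  map_mx (horner_eval 0) G = 1%:M ->
  exists2 q : {poly K}, q != 0 & forall t, q.[t] != 0 ->
    exists L U : 'M[K]_n, [/\ lower_unitriangular L, upper_invertible U
      & map_mx (horner_eval t) G = L *m U].
Proof.
elim: n G => [|n IHn] G G0.
  exists 1; rewrite ?oner_neq0 // => t _; exists 1%:M, 1%:M.
  by split; [split=> -[] | split=> -[] | apply/matrixP=> -[]].
pose G' : 'M_(1 + n) := G.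
pose a := ulsubmx G'; pose b := ursubmx G'; pose c := dlsubmx G'; pose D := drsubmx G'.
have GE : G = block_mx a b c D by rewrite submxK.
have : map_mx (horner_eval 0) (block_mx a b c D) = 1%:M by rewrite -GE.
rewrite map_block_mx (@scalar_mx_block _ 1 n).
move=> /eq_block_mx[a0 b0 c0 D0].
have a00 : (a 0 0).[0] = 1.
  have /matrixP/(_ 0 0) := a0; rewrite mxE [in RHS]mxE eqxx mulr1n; exact.
have [|q q0 LUq] := IHn (a 0 0 *: D - c *m b).
  rewrite map_mxB map_mxM b0 c0 mulmx0 subr0 map_horner_scale D0.
  by rewrite a00 scale1r.
(* Away from the roots of this product, both the pivot and those of the scaled Schur complement are
   nonzero. *)
exists (a 0 0 * q) => [|t].
  rewrite mulf_neq0 //; apply: contra_eq_neq a00 => ->.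
  by rewrite horner0 eq_sym oner_neq0.
rewrite hornerM mulf_eq0 negb_or => /andP[at0 /LUq[L' [U' [L'l U'u]]]].
set s := (a 0 0).[t] in at0 *.
rewrite map_mxB map_mxM map_horner_scale -/s => LUt.
have aE : map_mx (horner_eval t) a = s%:M.
  by apply/matrixP=> i j; rewrite !ord1 mxE [RHS]mxE eqxx mulr1n.
exists (block_mx 1%:M 0 (s^-1 *: map_mx (horner_eval t) c) L').
exists (block_mx s%:M (map_mx (horner_eval t) b) 0 (s^-1 *: U')).
split; [exact: lower_unitriangular_block | by apply: upper_invertible_block; rewrite ?invr_eq0 | ].
have -> : map_mx (horner_eval t) G = map_mx (horner_eval t) (block_mx a b c D).
  by rewrite -GE.
by rewrite map_block_mx aE; apply: block_LU.
Qed.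
End LU.

(** * Weights of the representation: upper bound, multiplicity of the highest one, symmetry *)

Section Weights.
Variables (K : numFieldType) (n d : nat) (P : 'M[{mpoly K[n * n]}]_d).
Hypothesis pev1 : pev P 1%:M = 1%:M.
Hypothesis pevM : {morph pev P : g h / g *m h}.

(** The torus matrix is a sum of monomials with matrix coefficients, and these coefficients are the
    projections onto the weight spaces. *)
Definition weight_proj (m : 'X_{1..n}) : 'M[K]_d := map_mx (mcoeff m) (torus P).

Lemma map_mcoeff_mulC m p q r (A : 'M[{mpoly K[n]}]_(p, q)) (B : 'M[K]_(q, r)) :
  map_mx (mcoeff m) (A *m map_mx (@mpolyC n K) B) = map_mx (mcoeff m) A *m B.
Proof.
apply/matrixP=> a b; rewrite mxE [in LHS]mxE [RHS]mxE raddf_sum /=.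
apply: eq_bigr => k _; rewrite [map_mx _ B k b]mxE [map_mx _ A a k]mxE.
by rewrite [in LHS]mulrC mcoeffCM mulrC.
Qed.

Lemma map_mevalC z p q (B : 'M[K]_(p, q)) :
  map_mx (meval z) (map_mx (@mpolyC n K) B) = B.
Proof. by apply/matrixP=> a b; rewrite !mxE mevalC. Qed.

Lemma mcoeff_character m : (character P)@_m = \tr (weight_proj m).
Proof.
rewrite /character /mxtrace raddf_sum.
by apply: eq_bigr => a _; rewrite [RHS]mxE.
Qed.

Lemma mcoeff_scale_vars (z : 'I_n -> K) (p : {mpoly K[n]}) m :
  (mmap (@mpolyC n K) (fun i => z i *: 'X_i) p)@_m = (\prod_i z i ^+ m i) * p@_m.
Proof.
rewrite [p in LHS]mpolyE [p in RHS]mpolyE.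
rewrite (raddf_sum (mmap (@mpolyC n K) (fun i => z i *: 'X_i))).
rewrite !(raddf_sum (mcoeff m)) mulr_sumr /=.
apply: eq_bigr => k _; rewrite mmapZ mmapX mcoeffCM mcoeffZ mulrCA; congr (_ * _).
have -> : mmap1 (fun i => z i *: 'X_i) k = (\prod_i z i ^+ k i) *: 'X_[k] :> {mpoly K[n]}.
  rewrite mpolyXE_id /mmap1 -scaler_prod; apply: eq_bigr => i _.
  by rewrite exprZn.
by rewrite mcoeffZ mcoeffX; have [->|_] := eqVneq k m; rewrite ?mulr0.
Qed.

Lemma weight_proj_pev_dz m z :
  weight_proj m *m pev P (dz z) = (\prod_i z i ^+ m i) *: weight_proj m.
Proof.
(* Multiplying by the action of [dz z] rescales the variables of the torus matrix by [z]; the claim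
   is the coefficient of this identity at [m]. *)
have e : torus P *m map_mx (@mpolyC n K) (pev P (dz z))
    = map_mx (mmap (@mpolyC n K) (fun i => z i *: 'X_i)) (torus P).
  apply/matrixP=> a b; apply: eq_meval => y; rewrite [in RHS]mxE meval_mmap.
  transitivity ((pev P (dz y) *m pev P (dz z)) a b).
    by rewrite -(meval_torus P y) -{2}(map_mevalC y (pev P (dz z))) -map_mxM [RHS]mxE.
  have -> : pev P (dz y) *m pev P (dz z) = pev P (dz (fun i => z i * y i)).
    rewrite -pevM; congr pev; apply/matrixP=> i j; rewrite mul_mx_diag !mxE.
    by case: eqP => [->|_]; rewrite ?mulr1n ?mulr0n ?mul0r // mulrC.
  rewrite -meval_torus mxE; apply: meval_eq => i.
  by rewrite mevalZ mevalXU.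
have /(congr1 (map_mx (mcoeff m))) := e => {}e.
rewrite -map_mcoeff_mulC.
by rewrite e; apply/matrixP=> a b; rewrite mxE [in LHS]mxE mcoeff_scale_vars !mxE.
Qed.

Variables (l : 'X_{1..n}) (v : 'cV[K]_d).
Hypothesis v_torus : forall z, (forall i, z i != 0) ->
  pev P (dz z) *m v = (\prod_i z i ^+ l i) *: v.
Hypothesis v_unip : forall u, upper_unitriangular u -> pev P u *m v = v.

Lemma weight_proj_hwv : weight_proj l *m v = v.
Proof.
have /(congr1 (map_mx (mcoeff l))) := torus_hwv v_torus => e.
have vE : map_mx (mcoeff l) ('X_[l] *: map_mx (@mpolyC n K) v) = v.
  apply/matrixP=> a b; rewrite mxE [in LHS]mxE [in LHS]mxE mulrC mcoeffCM mcoeffX.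
  by rewrite eqxx mulr1.
by rewrite map_mcoeff_mulC vE in e.
Qed.

Lemma pev_upper_hwv (U : 'M[K]_n) : upper_invertible U ->
  exists s, pev P U *m v = s *: v.
Proof.
case=> U0 U1; pose z i := U i i.
have -> : U = dz z *m (\matrix_(i, j) ((z i)^-1 * U i j)).
  by apply/matrixP=> i j; rewrite mul_diag_mx !mxE mulrA mulfV ?U1 // mul1r.
rewrite pevM -mulmxA v_unip; last first.
  split=> [i j ij|i]; rewrite mxE; first by rewrite U0 // mulr0.
  by rewrite mulVf // U1.
by rewrite (pev_dz_hwv v_torus); eexists.
Qed.

(** The line from the identity to [g] lies in the cell of products lower times upper, except at
    finitely many parameters, and the upper factor only rescales [v]. The vanishing thus extends
    along the line up to [g]. *)
Lemma big_cell (A : 'M[K]_d) :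
  (forall L, lower_unitriangular L -> A *m pev P L *m v = 0) ->
  forall g, A *m pev P g *m v = 0.
Proof.
move=> A0 g; pose G := mxline 1%:M (g - 1%:M).
have [|q q0 LU] := @LU_on_nonroots K n G.
  by rewrite horner_mxline scale0r addr0.
have e : map_mx polyC A *m ppath P G *m map_mx polyC v = 0.
  apply: (eq_poly_mx_on_nonroots q0) => t /LU[L [U [Ll Uu GLU]]].
  rewrite !map_mxM !map_hornerC horner_ppath GLU pevM mulmxA.
  have [s Us] := pev_upper_hwv Uu; rewrite -(mulmxA _ _ v) Us -scalemxAr A0 // scaler0.
  by apply/matrixP=> i j; rewrite !mxE /horner_eval horner0.
have := congr1 (map_mx (horner_eval 1)) e.
rewrite !map_mxM !map_hornerC horner_ppath horner_mxline scale1r addrC subrK => ->.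
by apply/matrixP=> i j; rewrite !mxE /horner_eval horner0.
Qed.

(** The pairing of the cocharacter [t ^ c] with the weight [m]. *)
Definition pair_wt (c : 'I_n -> nat) (m : 'X_{1..n}) : nat := \sum_i c i * m i.

(* Conjugating [L] by the cocharacter [t ^ c] contracts it to a limit at
   [t = 0], which bounds the weights occurring in [pev P L *m v]. *)
Lemma weight_lower (c : 'I_n -> nat) m L :
  (forall i j : 'I_n, (i <= j)%N -> (c j <= c i)%N) -> lower_unitriangular L ->
  let L0 := \matrix_(i, j) (L i j * (c i == c j)%:R) in
  (pair_wt c l <= pair_wt c m)%N ->
  weight_proj m *m pev P L *m v
  = 0 ^+ (pair_wt c m - pair_wt c l) *: (weight_proj m *m pev P L0 *m v).
Proof.
move=> cmon [Lu L1] L0 clm.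
(* This is [L] conjugated by the inverse of [Z]. The exponents [c j - c i] are true differences
   because [j <= i] and [c] is nonincreasing, so the path is defined at [t = 0], where only the
   entries with [c i = c j] remain. *)
pose Lt : 'M[{poly K}]_n := \matrix_(i, j)
  if (j <= i)%N then 'X^(c j - c i) * (L i j)%:P else 0.
pose Z : 'M[{poly K}]_n := diag_mx (\row_i 'X^(c i)).
have ZE t : map_mx (horner_eval t) Z = dz (fun i => t ^+ c i).
  apply/matrixP=> i j; rewrite !mxE /horner_eval.
  by case: eqP; rewrite ?mulr1n ?mulr0n ?horner0 // hornerXn.
have LZ : Z *m Lt = map_mx polyC L *m Z.
  apply/matrixP=> i j; rewrite mul_diag_mx mul_mx_diag !mxE.
  case: ltnP => ij; last first.
    by rewrite mulrA -exprD subnKC ?cmon // mulrC.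
  by rewrite Lu // mul0r mulr0.
have wtE t (k : 'X_{1..n}) : \prod_i (t ^+ c i) ^+ k i = t ^+ pair_wt c k :> K.
  by rewrite /pair_wt expr_sum; apply: eq_bigr => i _; rewrite exprM.
have Zl : map_mx polyC (weight_proj m) *m ppath P Z
    = 'X^(pair_wt c m) *: map_mx polyC (weight_proj m).
  apply: eq_poly_mx => t; rewrite map_horner_scale map_mxM map_hornerC horner_ppath.
  by rewrite ZE weight_proj_pev_dz wtE hornerXn.
have Zv : ppath P Z *m map_mx polyC v = 'X^(pair_wt c l) *: map_mx polyC v.
  apply: eq_poly_mx => t; rewrite map_horner_scale map_mxM map_hornerC horner_ppath.
  by rewrite ZE (pev_dz_hwv v_torus) wtE hornerXn.
pose Y := map_mx polyC (weight_proj m) *m ppath P Lt *m map_mx polyC v.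
pose x := weight_proj m *m pev P L *m v.
have xY : 'X^(pair_wt c m) *: Y = 'X^(pair_wt c l) *: map_mx polyC x.
  rewrite /Y /x scalemxAl scalemxAl -Zl -(mulmxA _ (ppath P Z)) -(ppathM pevM) LZ.
  rewrite (ppathM pevM) !mulmxA -mulmxA Zv ppathC -scalemxAr.
  by rewrite -!map_mxM.
have {}xY : map_mx polyC x = 'X^(pair_wt c m - pair_wt c l) *: Y.
  apply/matrixP=> a b; apply: (@mulfI _ 'X^(pair_wt c l)).
    by rewrite expf_neq0 // polyX_eq0.
  have /matrixP/(_ a b) := xY.
  move=> e.
  rewrite [X in _ * X = _]mxE [X in _ = _ * X]mxE mulrA -exprD subnKC //.
  by move: e; rewrite [X in X = _ -> _]mxE [X in _ = X -> _]mxE [X in _ = _ * X -> _]mxE => ->.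
have := congr1 (map_mx (horner_eval 0)) xY.
rewrite map_hornerC map_horner_scale hornerXn -/x => ->; congr (_ *: _).
rewrite /Y !map_mxM !map_hornerC horner_ppath; congr (_ *m pev P _ *m _).
apply/matrixP=> i j; rewrite !mxE /horner_eval; case: leqP => ij; last first.
  by rewrite horner0 Lu ?mul0r.
by rewrite hornerM hornerC hornerXn mulrC expr0n subn_eq0 eqn_leq (cmon _ _ ij).
Qed.

Hypothesis v_neq0 : v != 0.
Hypothesis irr : forall (A : 'M[K]_d) (x : 'cV[K]_d), x != 0 ->
  (forall g, g \in unitmx -> A *m pev P g *m x = 0) -> A = 0.

(** Otherwise the contraction produces a positive power of 0 on every lower unitriangular matrix, so
    the weight projection kills the orbit of [v] and vanishes. *)
Lemma character_weight_le (c : 'I_n -> nat) m :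
  (forall i j : 'I_n, (i <= j)%N -> (c j <= c i)%N) ->
  (character P)@_m != 0 -> (pair_wt c m <= pair_wt c l)%N.
Proof.
move=> cmon; apply: contraR; rewrite -ltnNge => clm.
rewrite mcoeff_character (irr (A := weight_proj m) v_neq0) ?raddf0 // => g _.
apply: big_cell => L Ll; rewrite (weight_lower cmon Ll) ?(ltnW clm) //.
by rewrite expr0n subn_eq0 leqNgt clm scale0r.
Qed.

(** A strictly decreasing [c] contracts [L] to the identity, so the projection to weight [l] sends
    the orbit of [v] into the line of [v]. It therefore factors as [v *m f *m weight_proj l] with
    [f *m v = 1], and its trace is 1. *)
Lemma character_highest : (character P)@_l = 1.
Proof.
have [i vi] : exists i, v i 0 != 0.
  apply/existsP; apply: contraNT v_neq0 => /existsPn v0; apply/eqP/matrixP => i j.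
  by rewrite ord1 mxE; apply/eqP; rewrite -[_ == _]negbK v0.
pose f : 'rV[K]_d := (v i 0)^-1 *: delta_mx 0 i.
have fv : f *m v = 1%:M.
  apply/matrixP=> a b; rewrite !ord1 -scalemxAl -rowE !mxE mulVf // mulr1n.
rewrite mcoeff_character.
have A0 : (1%:M - v *m f) *m weight_proj l = 0.
  apply: irr v_neq0 _ => g _; apply: big_cell => L Ll.
  pose c (j : 'I_n) := (n - j)%N.
  have cmon (j k : 'I_n) : (j <= k)%N -> (c k <= c j)%N by apply: leq_sub2l.
  rewrite -!mulmxA (mulmxA (weight_proj l)) (weight_lower cmon Ll) //.
  rewrite subnn expr0 scale1r.
  have -> : \matrix_(i, j) (L i j * (c i == c j)%:R) = 1%:M.
    case: Ll => L0 L1; apply/matrixP=> j k; rewrite !mxE.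
    have [<-|jk] := eqVneq j k; first by rewrite L1 eqxx mulr1.
    rewrite (_ : c j == c k = false) ?mulr0 //; apply: contra_neqF jk => /eqP.
    by rewrite /c => e; apply/ord_inj; move: (ltn_ord j) (ltn_ord k); lia.
  by rewrite pev1 mulmx1 weight_proj_hwv mulmxBl mul1mx -mulmxA fv mulmx1 subrr.
move/eqP: A0; rewrite mulmxBl mul1mx subr_eq0 => /eqP->.
by rewrite -mulmxA mxtrace_mulC -mulmxA weight_proj_hwv fv mxtrace1.
Qed.

Lemma meval_character_perm z (s : 'S_n) :
  (character P).@[fun i => z (s i)] = (character P).@[z].
Proof.
rewrite !meval_character.
have -> : dz (fun i => z (s i)) = perm_mx s *m dz z *m perm_mx s^-1.
  apply/matrixP=> i j; rewrite -row_permE -col_permE !mxE.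
  by rewrite (inj_eq perm_inj).
rewrite !pevM mxtrace_mulC mulmxA -pevM -perm_mxM mulVg perm_mx1 pev1.
by rewrite mul1mx.
Qed.
End Weights.

(** * The Weyl character formula from the radial equation *)

Section WeylCharacterFormula.
Variables (K : numFieldType) (n : nat).

(** Half the sum of the positive roots, shifted by a constant vector to have natural entries. *)
Definition rho : 'X_{1..n} := [multinom (n.-1 - i)%N | i < n].

Definition alternant (a : 'X_{1..n}) : {mpoly K[n]} :=
  \det (\matrix_(i, j) 'X_i ^+ a j).

Definition mperm (m : 'X_{1..n}) (s : 'S_n) : 'X_{1..n} := [multinom m (s i) | i < n].

Lemma alternantE a : alternant a = \sum_(s : 'S_n) (-1) ^+ s *: 'X_[mperm a s].
Proof.
apply: eq_bigr => s _; rewrite mpolyXE_id scaler_sign mulr_sign.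
by rewrite (eq_bigr (fun i => 'X_i ^+ mperm a s i)) // => i _; rewrite mxE mnmE.
Qed.

Lemma sqr_sum_perm (m : 'X_{1..n}) s : (\sum_i mperm m s i ^ 2 = \sum_i m i ^ 2)%N.
Proof.
rewrite [RHS](reindex_inj (@perm_inj _ s)); apply: eq_bigr => i _.
by rewrite mnmE.
Qed.

(** [rho (t i)] counts the [j] with [t i < t j], so twice the pairing is a sum over pairs of
    distinct indices, each contributing one of [c i] and [c j]; the identity permutation always
    selects the larger one. *)
Lemma rearrangement_rho (c : 'I_n -> nat) s :
  (forall i j : 'I_n, (i <= j)%N -> (c j <= c i)%N) ->
  (pair_wt c (mperm rho s) <= pair_wt c rho)%N.
Proof.
move=> cmon.
have E (t : 'S_n) : (2 * pair_wt c (mperm rho t)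
    = \sum_i \sum_j (c i * (t i < t j) + c j * (t j < t i)))%N.
  transitivity (\sum_i \sum_(j < n) c i * (t i < t j)
              + \sum_i \sum_(j < n) c j * (t j < t i))%N; last first.
    by rewrite -big_split; apply: eq_bigr => i _; rewrite big_split.
  rewrite [X in (_ + X)%N]exchange_big addnn mul2n; congr (_.*2).
  apply: eq_bigr => i _; rewrite !mnmE -big_distrr /=; congr (_ * _)%N.
  have -> : (n.-1 - t i = n - (t i).+1)%N by lia.
  rewrite -sum_ltn_ord [LHS](reindex_inj (@perm_inj _ t)).
  exact: eq_bigr.
have rho1 : rho = mperm rho 1 by apply/mnmP => i; rewrite !mnmE perm1.
rewrite -(@leq_pmul2l 2) // {2}rho1 !E.
apply: leq_sum => i _; apply: leq_sum => j _; rewrite !perm1.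
have := cmon i j; have := cmon j i.
have : (s i == s j) = (i == j) by rewrite (inj_eq perm_inj).
rewrite -!val_eqE /=.
case: (ltngtP i j); case: (ltngtP (s i) (s j)) => //=; rewrite ?muln0 ?muln1 ?addn0 ?add0n //; lia.
Qed.

(** The equality case of [2 x y <= x ^ 2 + y ^ 2], summed over the coordinates. *)
Lemma eq_mnm_cauchy (m a : 'X_{1..n}) :
  (\sum_i m i ^ 2 = \sum_i a i ^ 2)%N -> (\sum_i m i ^ 2 <= \sum_i m i * a i)%N -> m = a.
Proof.
move=> ma le.
have [] := @leqif_sum _ predT (fun i => m i == a i) (fun i => 2 * (m i * a i))%N
  (fun i => m i ^ 2 + a i ^ 2)%N (fun i _ => nat_Cauchy _ _).
have -> : (\sum_(i < n) 2 * (m i * a i) = 2 * \sum_(i < n) m i * a i)%N.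
  by rewrite big_distrr.
rewrite [X in (_ <= X)%N]big_split [X in _ == X]big_split /= -ma => le2 e.
apply/mnmP => i; apply/eqP; move: i; apply/forallP.
by rewrite -e eqn_leq le2 addnn -mul2n leq_pmul2l.
Qed.

Lemma mcoeff_alternant a m :
  (alternant a)@_m = \sum_(s : 'S_n) (-1) ^+ s * (mperm a s == m)%:R.
Proof.
rewrite alternantE raddf_sum; apply: eq_bigr => s _ /=.
by rewrite mcoeffZ mcoeffX.
Qed.

Lemma mcoeff_alternant_neq0 a m :
  (alternant a)@_m != 0 -> exists s : 'S_n, m = mperm a s.
Proof.
rewrite mcoeff_alternant => nz.
have [/existsP[s /eqP<-]|/existsPn no] := boolP [exists s : 'S_n, mperm a s == m].
  by exists s.
by case/eqP: nz; apply: big1 => s _; rewrite (negPf (no s)) mulr0.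
Qed.

Lemma meval_alternant a z :
  (alternant a).@[z] = \det (\matrix_(i, j) z i ^+ a j).
Proof.
rewrite /alternant -det_map_mx; congr (\det _); apply/matrixP => i j.
by rewrite !mxE rmorphXn /= mevalXU.
Qed.

Lemma mperm_inj_id (a : 'X_{1..n}) s : injective a -> (mperm a s == a) = (s == 1%g).
Proof.
move=> ainj; apply/eqP/eqP => [/mnmP e|->]; last first.
  by apply/mnmP => i; rewrite mnmE perm1.
by apply/permP => i; rewrite perm1; apply: ainj; have := e i; rewrite mnmE.
Qed.

Lemma mcoeff_alternant_lead (a : 'X_{1..n}) : injective a -> (alternant a)@_a = 1.
Proof.
move=> ainj; rewrite mcoeff_alternant (bigD1 1%g) //= mperm_inj_id // eqxx.
rewrite odd_perm1 expr0 mulr1 big1 ?addr0 // => s /negPf s1.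
by rewrite mperm_inj_id // s1 mulr0.
Qed.

Lemma msym_alternant a s : msym s (alternant a) = (-1) ^+ s *: alternant a.
Proof.
rewrite /alternant -det_map_mx scaler_sign -mulr_sign -det_perm -det_mulmx -row_permE.
congr (\det _); apply/matrixP => i j; rewrite !mxE rmorphXn /=; congr (_ ^+ _).
by rewrite /msym mmapX mmap1U.
Qed.

Lemma alternant_rho_Vandermonde : exists s : bool, alternant rho
  = (-1) ^+ s * \prod_(p < n) \prod_(q < n | (p < q)%N) ('X_q - 'X_p).
Proof.
have s_inj : injective (@rev_ord n) by apply: can_inj (@rev_ordK n).
exists (odd_perm (perm s_inj)).
pose A : 'rV[{mpoly K[n]}]_n := \row_i 'X_i.
have -> : alternant rho = \det (row_perm (perm s_inj) (Vandermonde n A)).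
  rewrite /alternant -det_tr; congr (\det _); apply/matrixP => i j.
  by rewrite !mxE permE mnmE /=; congr (_ ^+ _); have := ltn_ord i; lia.
rewrite row_permE det_mulmx det_perm det_Vandermonde; congr (_ * _).
by apply: eq_bigr => p _; apply: eq_bigr => q _; rewrite !mxE.
Qed.

Lemma euler_alternant_rho i z : (forall j k, j != k -> z j != z k) ->
  (euler i (alternant rho)).@[z]
  = (alternant rho).@[z] * \sum_(j | j != i) z i / (z i - z j).
Proof.
move=> zinj.
(* [x] is the logarithmic derivative of [p] at [z], additive over products; it is computed on each
   factor ['X_q - 'X_p] of the Vandermonde product, where its value is [t p q]. *)
pose D p x := (euler i p).@[z] = p.@[z] * x.
have D1 : D 1 0 by rewrite /D /euler -mpolyC1 mderivC !mulr0 meval0.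
have DM p x q y : D p x -> D q y -> D (p * q) (x + y).
  rewrite /D eulerM mevalD !mevalM => -> ->; ring.
have [s ->] := alternant_rho_Vandermonde.
pose t (p q : 'I_n) := z i * ((q == i)%:R - (p == i)%:R) / (z q - z p).
have /DM DV : D ((-1) ^+ s) 0.
  rewrite /D; case: s; rewrite ?expr0 ?expr1; last exact: D1.
  by rewrite linearN /= mevalN (_ : _.@[z] = 0) ?oppr0 ?mulr0 //; move: D1; rewrite /D mulr0.
have /DV : D (\prod_(p < n) \prod_(q < n | (p < q)%N) ('X_q - 'X_p))
             (\sum_(p < n) \sum_(q < n | (p < q)%N) t p q).
  apply: (big_ind2 D D1 DM) => p _; apply: (big_ind2 D D1 DM) => q pq.
  rewrite /D /t /euler mderivB !mderivXE mevalM !mevalB !mevalXU !mevalC.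
  rewrite mulrCA divff ?mulr1 //.
  by rewrite subr_eq0 zinj // -val_eqE gtn_eqF.
rewrite /D add0r => ->; congr (_ * _).
pose u (p q : 'I_n) := z i / (z q - z p).
have -> : \sum_(p < n) \sum_(q < n | (p < q)%N) t p q
   = \sum_(p < n | (p < i)%N) u p i - \sum_(q < n | (i < q)%N) u i q.
  transitivity (\sum_(p < n) \sum_(q < n | (p < q)%N)
      ((q == i)%:R * u p q - (p == i)%:R * u p q)).
    by apply: eq_bigr => p _; apply: eq_bigr => q _; rewrite /t /u; ring.
  under eq_bigr do rewrite sumrB; rewrite sumrB; congr (_ - _).
    rewrite [RHS]big_mkcond; apply: eq_bigr => p _; rewrite big_mkcond (bigD1 i) //=.
    rewrite eqxx mul1r big1 ?addr0 // => q /negPf->.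
    by rewrite mul0r if_same.
  rewrite (bigD1 i) //= [X in _ + X]big1 => [|p /negPf pi].
    by rewrite addr0; apply: eq_bigr => q _; rewrite eqxx mul1r.
  by apply: big1 => q _; rewrite pi mul0r.
rewrite [RHS](bigID (fun j : 'I_n => (j < i)%N)) /= -sumrN; congr (_ + _).
  by apply: eq_bigl => j; rewrite -val_eqE /=; lia.
apply: eq_big => [j|j _]; first by rewrite -val_eqE /=; lia.
by rewrite /u -mulrN -invrN opprB.
Qed.

Lemma mcoeff_laplace (p : {mpoly K[n]}) m :
  (\sum_i euler i (euler i p))@_m = (\sum_i m i ^ 2)%:R * p@_m.
Proof.
rewrite raddf_sum natr_sum mulr_suml; apply: eq_bigr => i _ /=.
by rewrite !mcoeff_euler -mulrnA mulr_natl mulnn.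
Qed.

Lemma meval_euler2M i (p q : {mpoly K[n]}) z :
  (euler i (euler i (p * q))).@[z]
  = (euler i (euler i p)).@[z] * q.@[z] + 2 * (euler i p).@[z] * (euler i q).@[z]
    + p.@[z] * (euler i (euler i q)).@[z].
Proof.
rewrite eulerM (raddfD (euler i)) /= (eulerM i (euler i p)) (eulerM i p (euler i q)).
move: (euler i (euler i p)) (euler i (euler i q)) (euler i p) (euler i q) => a b c e.
by rewrite !mevalD !mevalM; ring.
Qed.

Lemma laplace_alternant a :
  \sum_i euler i (euler i (alternant a)) = (\sum_i a i ^ 2)%:R *: alternant a.
Proof.
apply/mpolyP => m; rewrite mcoeff_laplace mcoeffZ.
have [->|/mcoeff_alternant_neq0[s ->]] := eqVneq (alternant a)@_m 0.
  by rewrite !mulr0.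
by rewrite sqr_sum_perm.
Qed.

Lemma rho_inj : injective rho.
Proof.
by move=> i j; rewrite !mnmE => e; apply/ord_inj; have := ltn_ord i; have := ltn_ord j; lia.
Qed.

Lemma rho_mon (i j : 'I_n) : (i <= j)%N -> (rho j <= rho i)%N.
Proof. by rewrite !mnmE => ij; apply: leq_sub2l. Qed.

Lemma pair_wtD (c : 'I_n -> nat) (x y : 'X_{1..n}) :
  pair_wt c (x + y)%MM = (pair_wt c x + pair_wt c y)%N.
Proof.
by rewrite /pair_wt -big_split; apply: eq_bigr => i _; rewrite mnmDE mulnDr.
Qed.

Lemma exists_mperm_noninc (m : 'X_{1..n}) : exists s : 'S_n,
  forall i j : 'I_n, (i <= j)%N -> (mperm m s j <= mperm m s i)%N.
Proof.
have /tuple_permP[s ms] : perm_eq (sort geq (val m)) (val m) by rewrite perm_sort.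
have geqT : transitive geq by move=> x y w /= xy yw; apply: leq_trans yw xy.
exists s => i j ij.
have E k : mperm m s k = nth 0%N (sort geq (val m)) k.
  rewrite ms mnmE (nth_map k) ?size_tuple ?card_ord // nth_ord_enum.
  by rewrite mnm_tnth.
rewrite !E; apply: (sorted_leq_nth geqT (fun x => leqnn x)) => //=.
- by apply: sort_sorted => x y; apply: leq_total.
- by rewrite inE size_sort size_tuple.
- by rewrite inE size_sort size_tuple.
Qed.

Lemma noninc_mperm_eq (m a : 'X_{1..n}) s :
  (forall i j : 'I_n, (i <= j)%N -> (m j <= m i)%N) ->
  (forall i j : 'I_n, (i <= j)%N -> (a j <= a i)%N) -> m = mperm a s -> m = a.
Proof.
move=> mmon amon e; have ma : perm_eq (val m) (val a).
  apply/tuple_permP; by exists s; rewrite e.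
have srt (b : 'X_{1..n}) :
    (forall i j : 'I_n, (i <= j)%N -> (b j <= b i)%N) -> sorted geq (val b).
  move=> bmon; apply/(sortedP 0%N) => i; rewrite size_tuple => iS.
  by have := bmon (Ordinal (ltnW iS)) (Ordinal iS) (leqnSn i); rewrite !(mnm_nth 0%N).
apply/val_inj/val_inj; apply: (sorted_eq (leT := geq)) ma; rewrite ?srt //.
  by move=> x y w /= xy yw; apply: leq_trans yw xy.
by move=> x y; rewrite andbC => /anti_leq.
Qed.

Variables (f : {mpoly K[n]}) (l : 'X_{1..n}).
Hypothesis l_mon : forall i j : 'I_n, (i <= j)%N -> (l j <= l i)%N.
Hypothesis f_lead : f@_l = 1.
Hypothesis f_le : forall (c : 'I_n -> nat) m,
  (forall i j : 'I_n, (i <= j)%N -> (c j <= c i)%N) ->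
  f@_m != 0 -> (pair_wt c m <= pair_wt c l)%N.
Hypothesis f_sym : forall (s : 'S_n) z, f.@[fun i => z (s i)] = f.@[z].
Hypothesis f_radial : forall z, (forall i j, i != j -> z i != z j) ->
  casimir_value K l * f.@[z]
  = \sum_i (euler i (euler i f)).@[z]
    + \sum_i \sum_(j | j != i) z i / (z i - z j)
        * ((euler i f).@[z] - (euler j f).@[z])
    + n.-1%:R * \sum_i (euler i f).@[z].

(** In the Leibniz expansion the cross terms reproduce the first-order part of the radial equation,
    through the logarithmic derivative of the Vandermonde determinant. The remaining term adds the
    squared norm of [rho] to [casimir_value], completing the square. *)
Lemma laplace_mul_alternant :
  \sum_i euler i (euler i (f * alternant rho))
  = (\sum_i (l + rho)%MM i ^ 2)%:R *: (f * alternant rho).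
Proof.
have V0 : alternant rho != 0.
  apply/eqP => /(congr1 (mcoeff rho)).
  by rewrite mcoeff_alternant_lead ?mcoeff0; [apply/eqP/oner_neq0 | apply: rho_inj].
apply: (eq_meval_on V0) => z Vz.
have zinj j k : j != k -> z j != z k.
  move=> jk; apply: contraNneq Vz => zjk; rewrite meval_alternant.
  by rewrite (determinant_alternate jk) // => k'; rewrite !mxE zjk.
have f_z := f_radial zinj.
pose S i := \sum_(j | j != i) z i / (z i - z j).
set w := (alternant rho).@[z].
pose a i := (euler i f).@[z].
(* Exchanging [i] and [j] in the terms with [a j], and spreading [n - 1] over the [j != i], reduces
   this to [(z i + z j) / (z i - z j) + 1 = 2 z i / (z i - z j)]. *)
have cross : \sum_i \sum_(j | j != i) z i / (z i - z j) * (a i - a j)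
    + n.-1%:R * \sum_i a i = 2 * \sum_i a i * S i.
  have -> : \sum_i \sum_(j | j != i) z i / (z i - z j) * (a i - a j)
     = \sum_i \sum_(j | j != i) (z i / (z i - z j) * a i - z j / (z j - z i) * a i).
    under eq_bigr do (under eq_bigr do rewrite mulrBr; rewrite sumrB).
    rewrite sumrB [X in _ - X](exchange_big_dep xpredT) //= -sumrB.
    apply: eq_bigr => i _; rewrite sumrB; congr (_ - _).
    by apply: eq_bigl => j; rewrite eq_sym.
  rewrite !mulr_sumr -big_split /=; apply: eq_bigr => i _.
  have -> : n.-1%:R * a i = \sum_(j | j != i) a i.
    by rewrite sumr_const cardC1 card_ord mulr_natl.
  rewrite -big_split /S !mulr_sumr; apply: eq_bigr => j ji /=.
  have zij : z i - z j != 0 by rewrite subr_eq0 zinj // eq_sym.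
  have -> : z j - z i = - (z i - z j) by rewrite opprB.
  by field.
have cas : (\sum_i (l + rho)%MM i ^ 2)%:R
    = casimir_value K l + (\sum_(i < n) rho i ^ 2)%:R.
  rewrite /casimir_value !natr_sum -big_split /=; apply: eq_bigr => i _.
  by rewrite mnmDE !natrX natrD mnmE; ring.
have lap : \sum_i (euler i (euler i (alternant rho))).@[z] = (\sum_(i < n) rho i ^ 2)%:R * w.
  by have := congr1 (meval z) (laplace_alternant rho); rewrite raddf_sum mevalZ.
rewrite mevalZ mevalM cas mulrDl !mulrA f_z -/w raddf_sum /=.
rewrite -[X in _ = X + _]/((_ + _ + _) * w) -[in RHS]addrA cross.
transitivity (\sum_i ((euler i (euler i f)).@[z] * w + 2 * (a i * S i) * w
    + f.@[z] * (euler i (euler i (alternant rho))).@[z])).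
  apply: eq_bigr => i _; rewrite meval_euler2M.
  rewrite (euler_alternant_rho i zinj) -/w -/(S i) -/(a i); ring.
rewrite big_split /=; congr (_ + _); last first.
  by rewrite -mulr_sumr lap mulrA [f.@[z] * _]mulrC.
by rewrite big_split /= -!mulr_suml mulrDl -mulr_sumr.
Qed.

(** The Laplacian gives [m] the norm of [l + rho]. Splitting [m] into a weight of [f] and a permuted
    [rho], and pairing both with [m] itself, bounds the squared norm of [m] by its product with
    [l + rho]; Cauchy's equality case concludes. *)
Lemma mcoeff_mul_alternant_noninc (m : 'X_{1..n}) :
  (forall i j : 'I_n, (i <= j)%N -> (m j <= m i)%N) ->
  (f * alternant rho)@_m != 0 -> m = (l + rho)%MM.
Proof.
move=> m_mon nz.
have m2 : (\sum_i m i ^ 2 = \sum_i (l + rho)%MM i ^ 2)%N.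
  have /(congr1 (mcoeff m)) := laplace_mul_alternant.
  rewrite mcoeff_laplace mcoeffZ => /(mulIf nz) /eqP.
  by rewrite Num.Theory.eqr_nat => /eqP.
apply: eq_mnm_cauchy => //.
have /msuppM_le/allpairsP[[m1 m2'] /= [m1f m2V mE]] : m \in msupp (f * alternant rho).
  by rewrite mcoeff_msupp.
have /mcoeff_alternant_neq0[s m2E] : (alternant rho)@_m2' != 0 by rewrite -mcoeff_msupp.
have le1 : (pair_wt m m1 <= pair_wt m l)%N by apply: f_le; rewrite // -mcoeff_msupp.
have le2 := rearrangement_rho s m_mon.
rewrite (_ : (\sum_i m i * (l + rho)%MM i)%N = pair_wt m (l + rho)%MM) // pair_wtD.
rewrite (_ : (\sum_i m i ^ 2)%N = pair_wt m m); last by apply: eq_bigr.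
have -> : pair_wt m m = pair_wt m (m1 + m2')%MM by rewrite -mE.
by rewrite pair_wtD m2E leq_add.
Qed.

(** Only the identity permutation contributes: a term from [s] would give, after pairing with [rho]
    and the weight bound, a product of [rho] with its permutation at least its squared norm, which
    forces [s = 1]. *)
Lemma mcoeff_mul_alternant_lead : (f * alternant rho)@_(l + rho)%MM = 1.
Proof.
rewrite alternantE mulr_sumr raddf_sum (bigD1 1%g) //= odd_perm1 expr0 scale1r.
have -> : mperm rho 1 = rho by apply/mnmP => i; rewrite mnmE perm1.
rewrite addmC mcoeffMX f_lead big1 ?addr0 // => s s1; rewrite -scalerAr mcoeffZ.
apply/eqP; rewrite mulf_eq0 signr_eq0 /=; apply: contraNT s1.
rewrite -mcoeff_msupp (perm_mem (msuppMX _ _)) => /mapP[m' m'f e].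
rewrite -(mperm_inj_id s rho_inj); apply/eqP/esym/eq_mnm_cauchy.
  by rewrite sqr_sum_perm.
have le1 : (pair_wt rho m' <= pair_wt rho l)%N.
  by apply: f_le; [apply: rho_mon | rewrite -mcoeff_msupp].
rewrite (_ : (\sum_i rho i * mperm rho s i)%N = pair_wt rho (mperm rho s)) //.
rewrite (_ : (\sum_i rho i ^ 2)%N = pair_wt rho rho); last by apply: eq_bigr.
have := congr1 (pair_wt rho) e; rewrite !pair_wtD; lia.
Qed.

(** The difference of the two sides is antisymmetric, so its coefficients need checking only at
    nonincreasing exponents; there both sides are supported on [l + rho], with coefficient 1. *)
Theorem weyl_character_formula : f * alternant rho = alternant (l + rho)%MM.
Proof.
have a_mon (i j : 'I_n) : (i <= j)%N -> ((l + rho)%MM j <= (l + rho)%MM i)%N.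
  by move=> ij; rewrite !mnmDE leq_add ?l_mon ?rho_mon.
have a_inj : injective (l + rho)%MM.
  move=> i j; rewrite !mnmDE => e; apply/ord_inj.
  have rE (k : 'I_n) : rho k = (n.-1 - k)%N by rewrite mnmE.
  move: e (ltn_ord i) (ltn_ord j); rewrite !rE.
  by case: (ltngtP i j) => // ij; have := l_mon (ltnW ij); lia.
have f_msym s : msym s f = f.
  by apply: eq_meval => z; rewrite /msym meval_mmap -[RHS](f_sym s);
    apply: meval_eq => i; rewrite mevalXU.
apply/eqP; rewrite -subr_eq0; set G := _ - _; apply/eqP/mpolyP => m; rewrite mcoeff0.
have [s s_mon] := exists_mperm_noninc m.
have G_sym : msym s G = (-1) ^+ s *: G.
  by rewrite /G msymB msymM f_msym !msym_alternant scalerBr scalerAr.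
have : (msym s G)@_m = G@_(mperm m s) by rewrite mcoeff_sym.
rewrite G_sym mcoeffZ => /eqP.
suff -> : G@_(mperm m s) = 0 by rewrite mulf_eq0 signr_eq0 => /eqP.
move: (mperm m s) s_mon => {}m m_mon; rewrite /G mcoeffB.
have [->|ma] := eqVneq m (l + rho)%MM.
  by rewrite mcoeff_mul_alternant_lead mcoeff_alternant_lead // subrr.
have [->|nz] := eqVneq (f * alternant rho)@_m 0; last first.
  by rewrite (mcoeff_mul_alternant_noninc m_mon nz) eqxx in ma.
have [->|nz] := eqVneq (alternant (l + rho)%MM)@_m 0; first by rewrite subrr.
have [t mt] := mcoeff_alternant_neq0 nz.
by rewrite (noninc_mperm_eq m_mon a_mon mt) eqxx in ma.
Qed.

End WeylCharacterFormula.

(** * From irreducible rational representations to the character formula *)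

Lemma linear_closed_vspace (K : fieldType) (vT : vectType K) (Q : vT -> Prop) :
  Q 0 -> (forall a x y, Q x -> Q y -> Q (a *: x + y)) ->
  exists U : {vspace vT}, forall x, x \in U <-> Q x.
Proof.
move=> Q0 QD.
(* Induction on a bound [k] for the codimension of [U]. As [Q] need not be decidable, excluded
   middle supplies a vector of [Q] outside [U] to adjoin. *)
suff step k : forall U : {vspace vT}, (forall x, x \in U -> Q x) ->
    (\dim {:vT} - \dim U <= k)%N ->
    exists U : {vspace vT}, forall x, x \in U <-> Q x.
  apply: (step (\dim {:vT}) 0%VS) => [x|]; last exact: leq_subr.
  by rewrite memv0 => /eqP->.
elim: k => [|k IHk] U QU Uk.
  exists U => x; split=> [/QU //|_].
  suff -> : U = fullv by rewrite memvf.
  by apply/eqP; rewrite eqEdim subvf /=; lia.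
have [UQ|/boolp.existsNP[x /boolp.not_implyP[Qx xU]]] := boolp.EM (forall x, Q x -> x \in U).
  by exists U => x; split=> [/QU|/UQ].
apply: (IHk (U + <[x]>)%VS) => [y /memv_addP[u uU [w /vlineP[a ->] ->]]|].
  by rewrite addrC; apply: QD => //; apply: QU.
have lt : (\dim U < \dim (U + <[x]>))%N.
  rewrite ltn_neqAle dimvS ?addvSl // andbT; apply/negP => /eqP e.
  have UE : U = (U + <[x]>)%VS by apply/eqP; rewrite eqEdim addvSl -e leqnn.
  by apply: xU; rewrite UE memvE addvSr.
have := dimvS (subvf (U + <[x]>)%VS); lia.
Qed.

Section Characters.
Variables (K : numFieldType) (n : nat).

(** The vectors whose whole orbit is killed by [A] form an invariant subspace; it contains [x],
    hence is everything, and [g = 1] then gives [A = 0]. *)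
Lemma irreducible_separates d (rho : 'M[K]_n -> 'M[K]_d) (A : 'M[K]_d) (x : 'cV[K]_d) :
  GL_representation rho -> irreducible_representation rho -> x != 0 ->
  (forall g, g \in unitmx -> A *m rho g *m x = 0) -> A = 0.
Proof.
case=> rho1 rhoM [d0 irr] x0 Ax.
have [||U UE] := @linear_closed_vspace _ _
  (fun y : 'cV[K]_d => forall g, g \in unitmx -> A *m rho g *m y = 0).
- by move=> g _; rewrite mulmx0.
- move=> a y z Ay Az g gu.
  by rewrite mulmxDr -scalemxAr Ay // Az // scaler0 addr0.
have xU : x \in U by apply/UE.
have [|U0|Uf] := irr U.
- move=> g y gu /UE Ay; apply/UE => h hu.
  by rewrite mulmxA -(mulmxA A) -rhoM // Ay // unitmx_mul hu.
- by move: xU; rewrite U0 memv0 (negPf x0).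
apply/matrixP=> i j; rewrite [RHS]mxE.
have /UE/(_ 1%:M (unitmx1 _ _)) : delta_mx j 0 \in U by rewrite Uf memvf.
rewrite rho1 mulmx1 => /matrixP/(_ i 0); rewrite [RHS]mxE => <-.
by rewrite -colE mxE.
Qed.

Definition det_mpoly : {mpoly K[n * n]} :=
  \det (\matrix_(i < n, j < n) 'X_(mxvec_index i j)).

Lemma mx_eval_det g : mx_eval det_mpoly g = \det g.
Proof.
rewrite /mx_eval /det_mpoly -det_map_mx; congr (\det _); apply/matrixP => i j.
by rewrite !mxE /= mevalXU mxvecE.
Qed.

Lemma rational_polynomial d (rho : 'M[K]_n -> 'M[K]_d) :
  (forall i j, regular_on_GL (fun g => rho g i j)) ->
  exists (N : nat) (P : 'M[{mpoly K[n * n]}]_d),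
    forall g, g \in unitmx -> pev P g = \det g ^+ N *: rho g.
Proof.
move=> reg.
have /fin_all_exists[p] : forall ij : 'I_d * 'I_d, exists p : {mpoly K[n * n]} * nat,
    forall g, g \in unitmx -> rho g ij.1 ij.2 = mx_eval p.1 g / \det g ^+ p.2.
  by case=> i j; have [p [k pk]] := reg i j; exists (p, k).
(* The largest power of the determinant among the entries is a common denominator. *)
move=> pE; exists (\max_ij (p ij).2)%N.
exists (\matrix_(i, j) ((p (i, j)).1 * det_mpoly ^+ (\max_ij (p ij).2 - (p (i, j)).2))).
move=> g gu; apply/matrixP=> i j; rewrite !mxE (pE (i, j) g gu) /=.
rewrite /mx_eval mevalM rmorphXn /= -/(mx_eval _ _) -/(mx_eval _ _) mx_eval_det.
have g0 : \det g != 0 by rewrite -unitfE -unitmxE.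
rewrite mulrCA; congr (_ * _); rewrite -[in RHS](@subnK (p (i, j)).2 (\max_ij _)).
  by rewrite exprD mulfK // expf_neq0.
exact: (leq_bigmax (F := fun ij => (p ij).2) (i, j)).
Qed.

(** Twisting by the [N]-th power of the determinant makes the representation polynomial and adds [N]
    to every weight. In the formula for the twist, both sides carry the factor
    [(\prod_i 'X_i) ^+ N], which cancels. *)
Lemma mx_eval_irreducible_character (lam : 'I_n -> int) (p : {mpoly K[n * n]}) :
  (forall i j : 'I_n, (i <= j)%N -> lam j <= lam i) -> (forall i, 0 <= lam i) ->
  is_irreducible_character lam (mx_eval p) ->
  on_torus p * alternant K (rho n) = alternant K [multinom (absz (lam i) + rho n i)%N | i < n].
Proof.
move=> lam_mon lam_ge0 [_ [d [R [[Rrep Rreg] Rirr [v [v0 v_tor v_uni]] chiE]]]].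
have [R1 RM] := Rrep.
have lamE i : lam i = absz (lam i) by rewrite gez0_abs.
have [N [P PE]] := rational_polynomial Rreg.
pose l : 'X_{1..n} := [multinom (absz (lam i) + N)%N | i < n].
have pev1 : pev P 1%:M = 1%:M by rewrite PE ?unitmx1 // det1 expr1n scale1r R1.
have pevM : {morph pev P : g h / g *m h}.
  apply: pev_morph => g h gu hu; rewrite !PE ?unitmx_mul ?gu // det_mulmx RM //.
  by rewrite exprMn -scalemxAl -scalemxAr scalerA.
have det_dz z : \det (dz z) = \prod_i z i.
  by rewrite det_diag; apply: eq_bigr => i _; rewrite mxE.
have dz_unit z : (forall i, z i != 0) -> dz z \in unitmx.
  by move=> z0; rewrite unitmxE det_dz unitfE; apply/prodf_neq0 => i _.
have P_tor z : (forall i, z i != 0) -> pev P (dz z) *m v = (\prod_i z i ^+ l i) *: v.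
  move=> z0; rewrite PE ?dz_unit // -scalemxAl v_tor => [|i]; last by rewrite mxE.
  rewrite scalerA det_dz -prodrXl -big_split; congr (_ *: _); apply: eq_bigr => i _.
  by rewrite mxE mnmE /= addnC exprD {1}lamE.
have P_uni u : upper_unitriangular u -> pev P u *m v = v.
  move=> uu; have det_u : \det u = 1.
    rewrite -det_tr det_trig; last first.
      by apply/is_trig_mxP => i j ij; rewrite mxE uu.1.
    by apply: big1 => i _; rewrite mxE uu.2.
  by rewrite PE ?unitmxE ?det_u ?unitr1 // expr1n scale1r v_uni.
have P_irr (A : 'M[K]_d) (x : 'cV[K]_d) : x != 0 ->
    (forall g, g \in unitmx -> A *m pev P g *m x = 0) -> A = 0.
  move=> x0 Ax; apply: (irreducible_separates Rrep Rirr x0) => g gu.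
  have := Ax g gu; rewrite PE // -scalemxAr -scalemxAl => /eqP.
  rewrite scaler_eq0 => /orP[|/eqP //].
  by rewrite expf_eq0 => /andP[_]; move: gu; rewrite unitmxE unitfE => /negPf->.
have wcf : character P * alternant K (rho n) = alternant K (l + rho n)%MM.
  apply: weyl_character_formula.
  - move=> i j /lam_mon; rewrite !mnmE leq_add2r => ij.
    by have := lam_ge0 i; have := lam_ge0 j; lia.
  - exact: (character_highest pev1 pevM P_tor P_uni v0 P_irr).
  - by move=> c m; apply: (character_weight_le pevM P_tor P_uni v0 P_irr).
  - by move=> s z; apply: meval_character_perm.
  - by move=> z; apply: (casimir_radial pevM P_tor P_uni v0 P_irr).
have chN : character P = on_torus p * (\prod_i 'X_i) ^+ N.
  apply: (eq_meval_on (prodX_neq0 K n)) => z; rewrite rmorph_prod => /prodf_neq0 z0.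
  have {}z0 i : z i != 0 by have := z0 i isT; rewrite /= mevalXU.
  rewrite meval_character PE ?dz_unit // mxtraceZ -chiE ?dz_unit // det_dz.
  rewrite mevalM meval_on_torus rmorphXn rmorph_prod /= mulrC; congr (_ * _ ^+ _).
  by apply: eq_bigr => i _; rewrite mevalXU.
have altN : alternant K (l + rho n)%MM
    = alternant K [multinom (absz (lam i) + rho n i)%N | i < n] * (\prod_i 'X_i) ^+ N.
  apply: eq_meval => z; rewrite mevalM !meval_alternant rmorphXn rmorph_prod /=.
  set M := (X in _ = \det X * _).
  transitivity (\det (diag_mx (\row_i z i ^+ N) *m M)).
    congr (\det _); apply/matrixP => i j; rewrite mul_diag_mx !mxE -exprD.
    by rewrite mnmDE !mnmE; congr (_ ^+ _); lia.
  rewrite det_mulmx det_diag mulrC -prodrXl; congr (_ * _).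
  by apply: eq_bigr => i _; rewrite mxE mevalXU.
apply: (mulIf (expf_neq0 N (prodX_neq0 K n))).
by rewrite -altN -wcf chN mulrAC.
Qed.
End Characters.

(** * Alternating multilinear forms and determinants *)

Section AlternatingForms.
Variables (K : fieldType) (V : lmodType K) (r : nat) (w : {ffun 'I_r -> V} -> K).
Hypothesis w_multilinear : multilinear w.
Hypothesis w_alternating : alternating w.

Lemma ffun_updE (m : {ffun 'I_r -> V}) i x j :
  ffun_upd m i x j = if j == i then x else m j.
Proof. by rewrite ffunE. Qed.

Lemma ffun_upd_id (m : {ffun 'I_r -> V}) i : ffun_upd m i (m i) = m.
Proof. by apply/ffunP => j; rewrite ffunE; case: eqP => [->|]. Qed.

Lemma multilinearD m i x y :
  w (ffun_upd m i (x + y)) = w (ffun_upd m i x) + w (ffun_upd m i y).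
Proof. by rewrite -[x]scale1r w_multilinear mul1r scale1r. Qed.

Lemma multilinear0 m i : w (ffun_upd m i 0) = 0.
Proof. by have /eqP := multilinearD m i 0 0; rewrite addr0 -subr_eq subrr eq_sym => /eqP. Qed.

Lemma multilinearZ m i a x : w (ffun_upd m i (a *: x)) = a * w (ffun_upd m i x).
Proof. by rewrite -[a *: x]addr0 w_multilinear multilinear0 addr0. Qed.

Lemma multilinear_sum m i (J : finType) (c : J -> K) (y : J -> V) :
  w (ffun_upd m i (\sum_k c k *: y k)) = \sum_k c k * w (ffun_upd m i (y k)).
Proof.
rewrite (big_morph (fun x => w (ffun_upd m i x)) (multilinearD m i) (multilinear0 m i)).
by apply: eq_bigr => k _; rewrite multilinearZ.
Qed.

Lemma alternating_tperm (m : {ffun 'I_r -> V}) i j : i != j ->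
  w [ffun k => m (tperm i j k)] = - w m.
Proof.
move=> ij; pose B x y := w (ffun_upd (ffun_upd m i x) j y).
have updC x y : ffun_upd (ffun_upd m i x) j y = ffun_upd (ffun_upd m j y) i x.
  apply/ffunP => k; rewrite !ffun_updE; have [->|//] := eqVneq k j.
  by rewrite eq_sym (negPf ij).
have BDr x y y' : B x (y + y') = B x y + B x y' by apply: multilinearD.
have BDl x x' y : B (x + x') y = B x y + B x' y by rewrite /B !updC multilinearD.
have Bxx x : B x x = 0.
  by apply: (w_alternating ij); rewrite !ffun_updE !eqxx (negPf ij).
have -> : w [ffun k => m (tperm i j k)] = B (m j) (m i).
  congr w; apply/ffunP => k; rewrite !ffunE.
  by case: tpermP => [->|->|/eqP/negPf ki /eqP/negPf kj]; rewrite ?eqxx ?(negPf ij) ?ki ?kj.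
have -> : w m = B (m i) (m j).
  by rewrite /B ffun_upd_id; congr w; apply/ffunP => k; rewrite ffun_updE; case: eqP => [->|].
have := Bxx (m i + m j); rewrite BDl !BDr !Bxx add0r addr0 => /eqP.
by rewrite addr_eq0 => /eqP->; rewrite opprK.
Qed.

Lemma alternating_perm (m : {ffun 'I_r -> V}) (s : 'S_r) :
  w [ffun k => m (s k)] = (-1) ^+ s * w m.
Proof.
have [ts -> ts_d] := prod_tpermP s.
elim: ts ts_d => [_|[i j] ts IH /= /andP[/= ij /IH {}IH]].
  rewrite big_nil odd_perm1 expr0 mul1r; congr w.
  by apply/ffunP => k; rewrite ffunE perm1.
rewrite big_cons odd_mul_tperm ij signr_addb expr1 mulN1r mulNr -IH.
rewrite -(alternating_tperm _ ij); congr w; apply/ffunP => k.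
by rewrite !ffunE permM.
Qed.

(** Expanding only the slots in [s] permits induction one slot at a time. The value [k0] imposed
    outside [s] makes each choice function on [s] occur exactly once. *)
Lemma multilinear_expand_seq (J : finType) (k0 : J) (c : 'I_r -> J -> K) (y : J -> V)
    (s : seq 'I_r) (m : {ffun 'I_r -> V}) : uniq s ->
  w [ffun i => if i \in s then \sum_k c i k *: y k else m i]
  = \sum_(f : {ffun 'I_r -> J} | [forall i, (i \notin s) ==> (f i == k0)])
      (\prod_(i <- s) c i (f i)) * w [ffun i => if i \in s then y (f i) else m i].
Proof.
elim: s m => [|x s IHs] m /=.
  move=> _; rewrite (big_pred1 [ffun=> k0]) => [|f].
    by rewrite big_nil mul1r; congr w; apply/ffunP => i; rewrite !ffunE.
  apply/forallP/eqP => [fk|-> i]; last by rewrite ffunE.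
  by apply/ffunP => i; rewrite ffunE; apply/eqP/(fk i).
case/andP=> xs s_uniq.
have mixE (u : 'I_r -> V) v :
    [ffun i => if i \in s then u i else ffun_upd m x v i]
    = ffun_upd [ffun i => if i \in s then u i else m i] x v.
  apply/ffunP => i; rewrite !ffunE; have [->|//] := eqVneq i x.
  by rewrite (negPf xs).
have -> : [ffun i => if i \in x :: s then \sum_k c i k *: y k else m i]
    = ffun_upd [ffun i => if i \in s then \sum_k c i k *: y k else m i] x
        (\sum_k c x k *: y k).
  by apply/ffunP => i; rewrite !ffunE in_cons; have [->|_] := eqVneq i x; rewrite ?eqxx.
rewrite (multilinear_sum _ x (c x) y) (partition_big (fun f : {ffun 'I_r -> J} => f x) xpredT) //=.
apply: eq_bigr => k _; rewrite -mixE IHs // mulr_sumr.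
(* The choice functions are grouped by their value [k] at [x]; resetting that value to [k0] is the
   bijection with the choice functions for [s]. *)
pose up (f : {ffun 'I_r -> J}) k' := [ffun i => if i == x then k' else f i].
rewrite [RHS](reindex_onto (fun f => up f k) (fun f => up f k0)); last first.
  move=> f /andP[_ /eqP fx]; apply/ffunP => i; rewrite !ffunE.
  by case: eqP => [->|].
apply: eq_big => [f|f _].
  have upx : up f k x = k by rewrite ffunE eqxx.
  rewrite upx eqxx andbT; apply/forallP/andP => [fk|[/forallP fk /eqP fE] i].
    split; last first.
      apply/eqP/ffunP => i; rewrite !ffunE; have [->|//] := eqVneq i x.
      by apply/esym/eqP/(implyP (fk x)).
    apply/forallP => i; rewrite in_cons negb_or ffunE; apply/implyP => /andP[/negPf-> nis].
    exact: (implyP (fk i)).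
  apply/implyP => nis; rewrite -fE !ffunE; have [//|ix] := eqVneq i x.
  have := implyP (fk i); rewrite in_cons negb_or ix nis => /(_ isT).
  by rewrite ffunE (negPf ix).
rewrite big_cons ffunE eqxx -mulrA; congr (_ * (_ * _)).
  rewrite !big_seq; apply: eq_bigr => i si; rewrite ffunE.
  by case: eqP si xs => // -> ->.
congr w; apply/ffunP => i; rewrite !ffunE in_cons.
by have [->|_] := eqVneq i x; rewrite ?(negPf xs).
Qed.

(** In the full expansion, noninjective choices repeat an argument and vanish; the others are
    permutations, whose signs give the Leibniz formula. *)
Lemma alternating_det (c : 'I_r -> 'I_r -> K) (y : 'I_r -> V) : (0 < r)%N ->
  w [ffun i => \sum_k c i k *: y k] = \det (\matrix_(i, k) c i k) * w [ffun k => y k].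
Proof.
move=> r0; pose k0 := Ordinal r0.
have := multilinear_expand_seq k0 c y [ffun=> 0] (enum_uniq 'I_r).
have -> : [ffun i => if i \in enum 'I_r then \sum_k c i k *: y k else [ffun=> 0] i]
    = [ffun i => \sum_k c i k *: y k].
  by apply/ffunP => i; rewrite !ffunE mem_enum.
move=> ->; rewrite (eq_bigl xpredT) => [|f]; last first.
  by apply/forallP => i; rewrite mem_enum.
transitivity (\sum_(f : {ffun 'I_r -> 'I_r}) (\prod_i c i (f i)) * w [ffun i => y (f i)]).
  apply: eq_bigr => f _; rewrite big_enum; congr (_ * w _).
  by apply/ffunP => i; rewrite !ffunE mem_enum.
rewrite (bigID (fun f : {ffun 'I_r -> 'I_r} => injectiveb f)) /= addrC big1 ?add0r; last first.
  move=> f /injectivePn[i [j ij fij]]; rewrite [w _](w_alternating ij) ?mulr0 //.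
  by rewrite !ffunE fij.
rewrite (reindex (fun s : 'S_r => val s)) /=; last first.
  exists (fun f => insubd (1%g : 'S_r) f) => [s _|f finj]; first by rewrite valKd.
  by rewrite /= insubdK.
rewrite mulr_suml; apply: eq_big => [s|s _]; first exact: (valP s).
have -> : [ffun i => y ((val s) i)] = [ffun i => [ffun k => y k] (s i)].
  by apply/ffunP => i; rewrite !ffunE pvalE.
rewrite alternating_perm mulrCA mulrA; congr (_ * _ * _).
by apply: eq_bigr => i _; rewrite mxE pvalE.
Qed.

Lemma multilinear_drop (x : 'I_r -> V) (b : 'I_r -> K) (e : V) :
  (forall (m : {ffun 'I_r -> V}) i, m i = e -> w m = 0) ->
  w [ffun i => b i *: e + x i] = w [ffun i => x i].
Proof.
(* The multiples of [e] are present in the first [k] slots only, and are removed one slot at a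
   time. *)
move=> we; pose m k := [ffun i : 'I_r => if (i < k)%N then b i *: e + x i else x i].
suff wm k : (k <= r)%N -> w (m k) = w [ffun i => x i].
  rewrite -(wm r) //; congr w; apply/ffunP => i; rewrite !ffunE.
  by rewrite ltn_ord.
elim: k => [_|k IHk kr].
  by congr w; apply/ffunP => i; rewrite !ffunE.
pose i := Ordinal kr; rewrite -IHk ?(ltnW kr) //.
have -> : m k.+1 = ffun_upd (m k) i (b i *: e + x i).
  apply/ffunP => j; rewrite ffun_updE !ffunE; have [->|ji] := eqVneq j i.
    by rewrite /= ltnSn.
  by rewrite ltnS leq_eqVlt (_ : (j == k :> nat) = false) //; apply: negPf ji.
rewrite w_multilinear (we _ i) ?ffun_updE ?eqxx // mulr0 add0r; congr w.
rewrite -[RHS](ffun_upd_id _ i); congr ffun_upd.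
by rewrite ffunE ltnn.
Qed.

End AlternatingForms.

(** * Conjugation-invariant polynomial functions on triangular matrices *)

Section ConjugationInvariant.
Variables (K : numFieldType) (n : nat) (p : {mpoly K[n * n]}).

Hypothesis p_conj : {in unitmx &, forall g h, mx_eval p (h *m g *m invmx h) = mx_eval p g}.

Lemma mx_eval_conj g h : h \in unitmx -> mx_eval p (h *m g *m invmx h) = mx_eval p g.
Proof.
move=> hu; pose G := mxline g 1%:M.
pose H := map_mx polyC h *m G *m map_mx polyC (invmx h).
have HE t : map_mx (horner_eval t) H = h *m map_mx (horner_eval t) G *m invmx h.
  by rewrite !map_mxM !map_hornerC.
have e : mx_path p H = mx_path p G.
  apply/eqP; rewrite -subr_eq0; apply/eqP.
  apply: (horner_eq0_on_nonroots (det_mxline1_neq0 g)) => t gt.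
  rewrite hornerD hornerN !horner_mx_path HE p_conj ?subrr //.
  by rewrite unitmxE det_map_mx unitfE.
have := congr1 (fun q : {poly K} => q.[0]) e.
by rewrite !horner_mx_path HE horner_mxline scale0r addr0.
Qed.

(* Conjugation by [diag (t ^ i)] contracts a lower triangular matrix to its
   diagonal as [t] tends to 0. *)
Lemma mx_eval_trig (A : 'M[K]_n) : is_trig_mx A ->
  mx_eval p A = mx_eval p (dz (fun i => A i i)).
Proof.
move=> /is_trig_mxP A0.
(* For [t != 0] this is [A] conjugated by [diag (t ^ i)]; the subtraction [i - j] truncates only
   above the diagonal, where [A] vanishes. *)
pose G : 'M[{poly K}]_n := \matrix_(i, j) ((A i j)%:P * 'X^(i - j)).
have GE t : t != 0 -> mx_eval p (map_mx (horner_eval t) G) = mx_eval p A.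
  move=> t0; pose D := dz (fun i : 'I_n => t ^+ i).
  have Du : D \in unitmx.
    by rewrite unitmxE det_diag unitfE; apply/prodf_neq0 => i _; rewrite mxE expf_neq0.
  rewrite -[RHS](mx_eval_conj A Du); congr mx_eval.
  apply: (canRL (mulmxK Du)); apply/matrixP => i j.
  rewrite mul_mx_diag mul_diag_mx !mxE /horner_eval hornerM hornerC hornerXn.
  have [ij|ji] := ltnP i j; first by rewrite A0 // !mul0r mulr0.
  by rewrite -mulrA -exprD subnK // mulrC.
have e : mx_path p G = (mx_eval p A)%:P.
  apply/eqP; rewrite -subr_eq0; apply/eqP.
  apply: (@horner_eq0_on_nonroots K _ 'X); first by rewrite polyX_eq0.
  move=> t; rewrite hornerX => /GE.
  by rewrite hornerD hornerN hornerC horner_mx_path => ->; rewrite subrr.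
have := congr1 (fun q : {poly K} => q.[0]) e; rewrite hornerC horner_mx_path => <-.
congr mx_eval; apply/matrixP => i j; rewrite !mxE /horner_eval hornerM hornerC hornerXn.
rewrite expr0n subn_eq0; have [<-|ij] := eqVneq i j; first by rewrite leqnn mulr1 mulr1n.
rewrite mulr0n; case: leqP => [ij'|]; last by rewrite mulr0.
by rewrite A0 ?mul0r // ltn_neqAle ij' andbT.
Qed.
End ConjugationInvariant.

(** * Powers reduced modulo a split polynomial *)

Section PowersModulo.
Variables (A : comNzRingType) (n : nat) (x : 'I_n -> A) (a : 'X_{1..n}).

Definition split_poly : {poly A} := \prod_i ('X - (x i)%:P).

(** Over any commutative ring, so that the roots can be indeterminates first and be specialized to
    the eigenvalues of [g] afterwards, even when these coincide. *)
Definition power_rem j : {poly A} := Pdiv.CommonRing.rmodp 'X^(a j) split_poly.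

(** The columns follow decreasing degree, like [rho]; the last one holds the constant terms. *)
Definition power_mx : 'M[A]_n := \matrix_(j, k) (power_rem j)`_(rho n k).

Lemma size_split_poly : size split_poly = n.+1.
Proof. by rewrite size_prod_XsubC /index_enum -enumT size_enum_ord. Qed.

Lemma size_power_rem j : (size (power_rem j) <= n)%N.
Proof.
rewrite -ltnS -size_split_poly Pdiv.CommonRing.ltn_rmodp monic_neq0 //.
exact: monic_prod_XsubC.
Qed.

Lemma power_remE j :
  'X^(a j) = Pdiv.CommonRing.rdivp 'X^(a j) split_poly * split_poly + power_rem j.
Proof. by apply: Pdiv.RingMonic.rdivp_eq; apply: monic_prod_XsubC. Qed.

Lemma power_rem_poly j : power_rem j = \sum_k power_mx j k *: 'X^(rho n k).
Proof.
rewrite -[LHS](take_poly_id (size_power_rem j)) /take_poly poly_def.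
rewrite [LHS](reindex_inj rev_ord_inj); apply: eq_bigr => k _.
have -> : rev_ord k = rho n k :> nat by rewrite mnmE /=; have := ltn_ord k; lia.
by rewrite mxE.
Qed.

Lemma power_mx_eval i j : x i ^+ a j = \sum_k power_mx j k * x i ^+ rho n k.
Proof.
have root_i : split_poly.[x i] = 0.
  by rewrite /split_poly horner_prod (bigD1 i) //= hornerXsubC subrr mul0r.
have := congr1 (horner^~ (x i)) (power_remE j).
rewrite /= hornerXn hornerD hornerM root_i mulr0 add0r => ->.
rewrite power_rem_poly horner_sum.
by apply: eq_bigr => k _; rewrite hornerZ hornerXn.
Qed.

Lemma power_mx_const j k : a j = 0%N -> (0 < n)%N -> power_mx j k = (rho n k == 0)%:R.
Proof.
move=> aj n0; rewrite mxE /power_rem aj expr0 Pdiv.CommonRing.rmodp_small ?coef1 //.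
by rewrite size_split_poly size_poly1 ltnS.
Qed.
End PowersModulo.

(** At a root a power equals its remainder, so the matrix of the alternant is the Vandermonde matrix
    times the transpose of [power_mx]. *)
Lemma alternant_power_mx (K : numFieldType) n (a : 'X_{1..n}) :
  alternant K a = alternant K (rho n) * \det (power_mx (fun i => 'X_i : {mpoly K[n]}) a).
Proof.
rewrite /alternant -[\det (power_mx _ _)]det_tr -det_mulmx; congr (\det _).
apply/matrixP => i j; rewrite mxE [RHS]mxE.
rewrite (power_mx_eval (fun i => 'X_i : {mpoly K[n]}) a i j).
by apply: eq_bigr => k _; rewrite mulrC [in RHS]mxE [(_^T) _ _]mxE.
Qed.

(** The character formula and [alternant_power_mx] factor the same alternant, and the nonzero
    [alternant K (rho n)] cancels. *)
Lemma on_torus_irreducible_character (K : numFieldType) n (lam : 'I_n -> int)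
    (p : {mpoly K[n * n]}) :
  (forall i j : 'I_n, (i <= j)%N -> lam j <= lam i) -> (forall i, 0 <= lam i) ->
  is_irreducible_character lam (mx_eval p) ->
  on_torus p = \det (power_mx (fun i => 'X_i : {mpoly K[n]})
                      [multinom (absz (lam i) + rho n i)%N | i < n]).
Proof.
move=> lam_mon lam_ge0 /(mx_eval_irreducible_character lam_mon lam_ge0).
rewrite (alternant_power_mx _ [multinom _ | i < n]) mulrC; apply: mulfI.
apply/eqP => /(congr1 (mcoeff (rho n))).
by rewrite mcoeff_alternant_lead ?mcoeff0; [apply/eqP/oner_neq0 | apply: rho_inj].
Qed.

(** The Euclidean division is specialized along [f] and evaluated at [g], which annihilates the
    specialized divisor. *)
Lemma expmx_power_mx (A : comNzRingType) (K : fieldType) r (f : {rmorphism A -> K})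
    (x : 'I_r.+1 -> A) (a : 'X_{1..r.+1}) (g : 'M[K]_r.+1) j :
  horner_mx g (\prod_i ('X - (f (x i))%:P)) = 0 ->
  g ^+ a j = \sum_k f (power_mx x a j k) *: g ^+ rho r.+1 k.
Proof.
move=> gz; have := congr1 (horner_mx g \o map_poly f) (power_remE x a j).
rewrite /= map_polyXn rmorphXn /= horner_mx_X rmorphD rmorphM /=.
have -> : map_poly f (split_poly x) = \prod_i ('X - (f (x i))%:P).
  rewrite rmorph_prod; apply: eq_bigr => i _.
  by rewrite /= rmorphB /= map_polyX map_polyC.
rewrite rmorphD rmorphM /= gz mulr0 add0r => ->.
rewrite power_rem_poly !raddf_sum; apply: eq_bigr => k _.
rewrite /= map_polyZ map_polyXn /= -mul_polyC rmorphM /= horner_mx_C rmorphXn /= horner_mx_X.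
by rewrite -mul_scalar_mx.
Qed.

Lemma horner_mx_conj_trig (K : fieldType) r (A Q : 'M[K]_r.+1) :
  Q \in unitmx -> is_trig_mx A ->
  horner_mx (invmx Q *m A *m Q) (\prod_i ('X - (A i i)%:P)) = 0.
Proof.
move=> Qu A_trig; rewrite mxred.horner_mx_uconjC // -(char_poly_trig A_trig).
by rewrite Cayley_Hamilton mulmx0 mul0mx.
Qed.

Lemma det_last_row_delta (R : comNzRingType) r (A : 'M[R]_r.+1) :
  (forall k, A ord_max k = (k == ord_max)%:R) ->
  \det A = \det (\matrix_(i < r, k < r) A (widen_ord (leqnSn r) i) (widen_ord (leqnSn r) k)).
Proof.
move=> A_max; rewrite (expand_det_row A ord_max) (bigD1 ord_max) //= big1 ?addr0.
  rewrite A_max eqxx mul1r /cofactor addnn -signr_odd odd_double expr0 mul1r.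
  congr (\det _); apply/matrixP => i k; rewrite !mxE; congr (A _ _);
    by apply/ord_inj; rewrite lift_max.
by move=> k /negPf k_max; rewrite A_max k_max mul0r.
Qed.

(** * Assembly of the identity at a triangular form of [g] *)

Theorem corollary1p3 (R : realType) (r : nat) (hr : (1 <= r)%N)
  (w : {ffun 'I_r -> 'M[R[i]]_r.+1} -> R[i])
  (w_multilinear : multilinear w)
  (w_alternating : alternating w)
  (w_one : forall (m : {ffun 'I_r -> 'M[R[i]]_r.+1}) (i : 'I_r),
     m i = 1%:M -> w m = 0)
  (lam : 'I_r.+1 -> int)
  (lam_dominant : forall i j : 'I_r.+1, (i <= j)%N -> lam j <= lam i)
  (lam_last : lam ord_max = 0)
  (chi : 'M[R[i]]_r.+1 -> R[i])
  (chi_lam : is_irreducible_character lam chi)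
  (g : 'M[R[i]]_r.+1) :
  w [ffun i : 'I_r => g ^ (lam (widen_ord (leqnSn r) i) + (r - i)%N%:Z)]
  = chi g * w [ffun i : 'I_r => g ^+ (r - i)].
Proof.
have lam_ge0 i : 0 <= lam i by rewrite -lam_last lam_dominant // -ltnS.
have lamE i : lam i = absz (lam i) by rewrite gez0_abs.
have [[p pE] [d [pi [pi_rat pi_irr pi_hw chiE]]]] := chi_lam.
have p_lam : is_irreducible_character lam (mx_eval p).
  split; first by exists p.
  by exists d, pi; split=> // h hu; rewrite -pE chiE.
have p_conj : {in unitmx &, forall g h, mx_eval p (h *m g *m invmx h) = mx_eval p g}.
  move=> x h xu hu; have [[pi1 piM] _] := pi_rat.
  rewrite -!pE !chiE ?unitmx_mul ?hu ?xu ?unitmx_inv //.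
  rewrite !piM ?unitmx_mul ?hu ?xu ?unitmx_inv // mxtrace_mulC mulmxA -piM ?unitmx_inv //.
  by rewrite mulVmx // pi1 mul1mx.
(* Schur triangularization over the complex numbers: the diagonal of [A] lists the eigenvalues of
   [g] with multiplicity. *)
have [Q Qunitary A_trig] := spectral.Schur g (ltn0Sn r).
have Qu : Q \in unitmx by apply: spectral.unitarymx_unit.
rewrite /similar_to /= mxred.conjumx // in A_trig; set A := Q *m g *m invmx Q in A_trig.
pose z i := A i i; pose widen := widen_ord (leqnSn r).
have gA : g = invmx Q *m A *m Q by rewrite /A !mulmxA mulVmx // mul1mx mulmxKV.
have chi_g : chi g = (on_torus p).@[z].
  by rewrite meval_on_torus pE -(mx_eval_trig p_conj A_trig) mx_eval_conj.
have g_annihilated : horner_mx g (\prod_i ('X - (z i)%:P)) = 0.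
  by rewrite {1}gA; apply: horner_mx_conj_trig.
pose a := [multinom (absz (lam i) + rho r.+1 i)%N | i < r.+1].
pose x i : {mpoly R[i][r.+1]} := 'X_i.
pose c i k := (power_mx x a i k).@[z].
have gX j : g ^+ a j = \sum_k c j k *: g ^+ rho r.+1 k.
  have := @expmx_power_mx _ _ _ (meval z) x a g j; rewrite /c => -> //.
  by rewrite -[RHS]g_annihilated; congr horner_mx; apply: eq_bigr => i _; rewrite /= mevalXU.
(* Since [lam ord_max = 0], the last exponent is 0 and its remainder is the constant 1; the full
   determinant therefore reduces to its leading minor of size [r]. *)
have c_max k : c ord_max k = (k == ord_max)%:R.
  rewrite /c power_mx_const ?mnmE ?lam_last ?subnn //=.
  rewrite (_ : (r - k == 0)%N = (k == ord_max)).
    by case: (k == ord_max); rewrite ?meval1 ?meval0.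
  by rewrite -val_eqE /=; have := ltn_ord k; lia.
have det_c : \det (\matrix_(i < r, k < r) c (widen i) (widen k)) = chi g.
  have -> : chi g = \det (\matrix_(i, k) c i k).
    have := on_torus_irreducible_character lam_dominant lam_ge0 p_lam.
    rewrite chi_g => ->; rewrite -det_map_mx; congr (\det _).
    by apply/matrixP => i k; rewrite [LHS]mxE [RHS]mxE.
  rewrite det_last_row_delta => [|k]; last by rewrite mxE c_max.
  by congr (\det _); apply/matrixP => i k; rewrite !mxE.
rewrite -det_c -(alternating_det w_multilinear w_alternating _ _ hr).
(* The components along the identity matrix, missing from the [r] by [r] minor, are restored in each
   argument without changing the value of [w]. *)
rewrite -[RHS](multilinear_drop w_multilinear _ (fun i => c (widen i) ord_max) w_one).
congr w; apply/ffunP => i; rewrite !ffunE lamE -PoszD.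
rewrite -[LHS]/(g ^+ (absz (lam (widen i)) + (r - i))).
have -> : (absz (lam (widen i)) + (r - i) = a (widen i))%N by rewrite !mnmE.
rewrite gX big_ord_recr /= addrC; congr (_ + _).
  by rewrite mnmE /= subnn expr0.
by apply: eq_bigr => k _; rewrite mnmE.
Qed.
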